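(* Let $j>0$, $u\in L^\infty([0,1],\mathbb R_+)$ with $F(0;u)>0$. Then $$S^{(\delta,-)}_t(u)\le S^{(\delta',+)}_t(u)$$ for all $\delta,\delta'>0$ and $t$ such that $u\in\mathcal U_\delta\cap\mathcal U_{\delta'}$ and $t=k\delta=k'\delta'$ with $k,k'\in\mathbb N$, where $\le$ is the order of mass transport defined below.
   Context: For a positive Borel measure $\mu$ on $[0,1]$ let $F(r;\mu)=\mu([r,1])$ (for a density $u$, $F(r;u)=\int_r^1u$). $\mathcal U$ is the set of positive measures $u=c_uD_0+\rho_u(r)dr$ with $c_u\ge0$, $\rho_u\in L^\infty([0,1],\mathbb R_+)$, $D_0$ the Dirac mass at $0$. For $u,v\in\mathcal U$, $u\le v$ iff $F(r;u)\le F(r;v)$ for all $r\in[0,1]$. For $\delta>0$, $\mathcal U_\delta=\{u=c_uD_0+\rho_u\in\mathcal U:F(0;\rho_u)>j\delta\}$ and the cut-and-paste operator $K^{(\delta)}:\mathcal U_\delta\to\mathcal U$ is $K^{(\delta)}u=j\delta D_0+\mathbf 1_{[0,R_\delta(u)]}u$, $R_\delta(u)=\inf\{r:F(r;u)=j\delta\}$. $G^{\rm neum}_t(r,r')=\sum_kG_t(r,r'_k)$, $G_t(r,r')=e^{-(r-r')^2/2t}/\sqrt{2\pi t}$, where $r'_k$ are the images of $r'$ under repeated reflections of $[0,1]$ to the right and left (heat kernel of $\partial_t=\frac12\partial_r^2$ on $[0,1]$ with Neumann boundary conditions); $G^{\rm neum}_t*\mu(r)=\int G^{\rm neum}_t(r,r')\mu(dr')$.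 Barriers: for $u\in L^\infty([0,1],\mathbb R_+)$ with $F(0;u)>j\delta$, set $S^{(\delta,\pm)}_0(u)=u$ and for $n\ge1$: $S^{(\delta,-)}_{n\delta}(u)=K^{(\delta)}G^{\rm neum}_\delta*S^{(\delta,-)}_{(n-1)\delta}(u)$, $S^{(\delta,+)}_{n\delta}(u)=G^{\rm neum}_\delta*K^{(\delta)}S^{(\delta,+)}_{(n-1)\delta}(u)$. *)

(* Defs.v *)
From HB Require Import structures.
From mathcomp Require Import all_boot all_order all_algebra.
From mathcomp Require Import all_classical all_reals all_analysis.
Set Implicit Arguments. Unset Strict Implicit. Unset Printing Implicit Defensive.
Import Order.TTheory GRing.Theory Num.Theory.
Import numFieldNormedType.Exports.
Local Open Scope classical_set_scope.
Local Open Scope ring_scope.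

Section Defs.
Variable R : realType.

Definition leb := (@lebesgue_measure R).

(* An element of U: u = c_u D_0 + rho_u(r) dr, represented by the pair (c_u, rho_u). *)
Definition umeas := (R * (R -> R))%type.
Definition c_of (u : umeas) : R := u.1.
Definition rho_of (u : umeas) : R -> R := u.2.

Definition Linf_pos (f : R -> R) : Prop :=
  measurable_fun (`[0, 1]%classic : set R) f /\
  (forall x, 0 <= x <= 1 -> 0 <= f x) /\
  exists M : R, {ae leb, forall x : R, 0 <= x <= 1 -> f x <= M}.

Definition Fd (r : R) (f : R -> R) : R := \int[leb]_(x in `[r, 1]) f x.

(* F(r; mu) = mu([r,1]) for mu = c D_0 + rho dr *)
Definition F (r : R) (u : umeas) : R :=
  (if (0 <= r) && (r <= 0) then c_of u else 0) + Fd r (rho_of u).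

Definition ule (u v : umeas) : Prop :=
  forall r, 0 <= r <= 1 -> F r u <= F r v.

Definition in_Udelta (j delta : R) (u : umeas) : Prop :=
  Fd 0 (rho_of u) > j * delta.

Definition Rdelta (j delta : R) (u : umeas) : R :=
  inf [set r | 0 <= r <= 1 /\ F r u = j * delta].

Definition Kcut (j delta : R) (u : umeas) : umeas :=
  (j * delta + c_of u,
   fun r => if (0 <= r) && (r <= Rdelta j delta u) then rho_of u r else 0).

Definition Gauss (t x : R) : R := expR (- (x ^+ 2) / (2 * t)) / Num.sqrt (2 * pi * t).

(* Neumann heat kernel: sum over all images r'_k of r' under the reflections of [0,1],
   i.e. r' + 2k and 2k - r' for k in Z; the sum over Z is written as a series over nat
   pairing k = n and k = -(n+1). *)
Definition Gneum (t r r' : R) : R :=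
  limn (series (fun n : nat =>
    Gauss t (r - (r' + 2 * n%:R)) + Gauss t (r - (2 * n%:R - r'))
  + Gauss t (r - (r' - 2 * n.+1%:R)) + Gauss t (r - (- 2 * n.+1%:R - r')))).

(* G^neum_t * mu (r) = int G^neum_t(r,r') mu(dr'); the result is a density *)
Definition Gconv (t : R) (u : umeas) : umeas :=
  (0, fun r => c_of u * Gneum t r 0 + \int[leb]_(r' in `[0, 1]) (Gneum t r r' * rho_of u r')).

Fixpoint Sminus (j delta : R) (u : R -> R) (n : nat) : umeas :=
  match n with
  | 0 => (0, u)
  | n.+1 => Kcut j delta (Gconv delta (Sminus j delta u n))
  end.

Fixpoint Splus (j delta : R) (u : R -> R) (n : nat) : umeas :=
  match n with
  | 0 => (0, u)
  | n.+1 => Gconv delta (Kcut j delta (Splus j delta u n))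
  end.

End Defs.

(* Main.v *)
Require Import Defs.
From HB Require Import structures.
From mathcomp Require Import all_boot all_order all_algebra.
From mathcomp Require Import all_classical all_reals all_analysis.
From mathcomp Require Import measurable_realfun ring lra.
Set Implicit Arguments. Unset Strict Implicit. Unset Printing Implicit Defensive.
Import Order.TTheory GRing.Theory Num.Theory.
Import numFieldNormedType.Exports.
Local Open Scope classical_set_scope.
Local Open Scope ring_scope.

(** Both barriers are compared with the barriers for a common refinement
    [e = delta / k' = delta' / k] of the two time steps:
    [S-(delta) <= S-(e) <= S+(e) <= S+(delta')].  Each inequality follows from
    the monotonicity of [K] and [G] for the mass transport order, from the
    semigroup property of [G], and from [K G u <= G K u]; the latter holds since
    [G K u] differs from [G u] by the displacement of mass [j delta] only.

    The monotonicity of [G] amounts to the fact that the Neumann heat flow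
    preserves nondecreasing functions on [[0, 1]].  By unfolding, this flow is
    convolution with a Gaussian on the line, acting on even 2-periodic
    functions.  A symmetric unimodal kernel supported in [[-1/2, 1/2]] preserves
    the even 2-periodic functions that are nondecreasing on [[0, 1]] (reflection
    coupling).  The Gaussian of variance [T] is the [n]-th convolution power of
    the Gaussian of variance [T / n], whose mass outside [[-1/2, 1/2]] is so
    small that truncating all [n] factors costs [O(1/n)]. *)

(** * Convolution on the line *)

(** The order tests a measure only on the intervals [[r, 1]]. Since [G] is self-adjoint,
    [F r (Gconv t u)] is the integral against [u] of the heat evolution of an indicator; if that
    evolution is nondecreasing, a layer-cake decomposition leads back to intervals ending at 1.
    Monotonicity cannot be seen pointwise under the full Gaussian: after reflection about [c], the
    inequality [f (c - s) <= f (c + s)] holds for [0 <= s <= 1] but is reversed on the other half of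
    the period, where the Gaussian does not vanish. A kernel of half-width 1/2 never reaches that
    half. Cutting the time into [n] steps makes each tail exponentially small in [n], so that even
    the sum of [n] of them vanishes. The atom at 0 needs separate care, because [F] may jump there.
    At [r = 0] the function [F] is the total mass, which [K] and [G] conserve; for [r > 0] it sees
    only the density, and a cut acts on it as [max (F - j d) 0]. Identities such as the semigroup
    law are stated through [F], which is all that the order sees. *)

Section GaussianConvolution.
Context {R : realType}.
Local Notation mu := (@lebesgue_measure R).
Implicit Types (f g : R -> \bar R) (k l : R -> R) (s t x y z : R).

Lemma ge0_integralN f : measurable_fun [set: R] f -> (forall x, 0 <= f x)%E ->
  (\int[mu]_x f (- x)%R = \int[mu]_x f x)%E.
Proof.
move=> mf f0.
have {1}-> : [set: R] = (-%R : _ -> measurableTypeR R) @^-1` [set: R] by [].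
transitivity (\int[pushforward mu (-%R : _ -> measurableTypeR R)]_x f x)%E.
  by rewrite ge0_integral_pushforward.
by apply: eq_measure_integral => A mA _; exact: lebesgue_measureN.
Qed.

Lemma lebesgue_measure_shift (a : R) (A : set R) : measurable A ->
  pushforward mu (fun x => x + a : measurableTypeR R) A = mu A.
Proof.
move=> mA.
have ma : measurable_fun [set: R] (fun x : R => x + a : measurableTypeR R).
  exact: measurable_funD.
apply/esym.
apply: (lebesgue_measure_unique (mu := [the measure _ _ of pushforward mu (fun x : R => x + a : measurableTypeR R)])) => //= _ [[b c]] _ <-.
rewrite /pushforward/=.
rewrite (_ : _ @^-1` _ = `]b - a, c - a]%classic); last first.
  by apply/seteqP; split => x /=; rewrite !in_itv/= ltrBlDr lerBrDr.
rewrite lebesgue_measure_itv/= lebesgue_measure_itv/= !lte_fin ltrD2r.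
by case: ifP => // _; rewrite -!EFinB; congr EFin; ring.
Qed.

Lemma ge0_integral_shift f a : measurable_fun [set: R] f -> (forall x, 0 <= f x)%E ->
  (\int[mu]_x f (x + a)%R = \int[mu]_x f x)%E.
Proof.
move=> mf f0.
have ma : measurable_fun [set: R] (fun x : R => x + a : measurableTypeR R).
  exact: measurable_funD.
transitivity (\int[pushforward mu (fun x => (x + a)%R : measurableTypeR R)]_x f x)%E.
  by rewrite ge0_integral_pushforward// preimage_setT.
by apply: eq_measure_integral => A mA _; exact: lebesgue_measure_shift.
Qed.

Lemma Gauss_ge0 t x : 0 <= Gauss t x.
Proof. by rewrite divr_ge0 ?expR_ge0 ?sqrtr_ge0. Qed.

Lemma GaussN t x : Gauss t (- x) = Gauss t x.
Proof. by rewrite /Gauss sqrrN. Qed.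

Lemma measurable_Gauss t : measurable_fun [set: R] (Gauss t).
Proof.
apply: measurable_funM => //.
apply: measurableT_comp => //; apply: measurable_funM => //.
by apply: measurableT_comp => //; exact: measurable_funX.
Qed.

Lemma Gauss_normal_pdf t m x : 0 < t ->
  Gauss t (x - m) = normal_pdf m (Num.sqrt t) x.
Proof.
move=> t0; rewrite normal_pdfE ?gt_eqF ?sqrtr_gt0//.
rewrite /Gauss mulrC /normal_peak /normal_fun sqr_sqrtr ?ltW//.
by congr (_^-1 * expR (_ / _)); [congr Num.sqrt; rewrite -mulr_natl; ring|rewrite mulr_natl].
Qed.

Lemma integral_Gauss t m : 0 < t -> (\int[mu]_x (Gauss t (x - m))%:E = 1)%E.
Proof.
move=> t0; under eq_integral do rewrite Gauss_normal_pdf//.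
by rewrite integral_normal_pdf// gt_eqF ?sqrtr_gt0.
Qed.

(** Completing the square in [x]: the second factor is the law of the intermediate point of a
    Brownian bridge, with mean [(t z + s y) / (s + t)] and variance [s t / (s + t)]. Its total mass
    1 then gives the semigroup law. *)
Lemma Gauss_mul s t x y z : 0 < s -> 0 < t ->
  Gauss s (z - x) * Gauss t (x - y) =
  Gauss (s + t) (z - y) * Gauss (s * t / (s + t)) (x - (t * z + s * y) / (s + t)).
Proof.
move=> s0 t0; rewrite /Gauss.
have st0 : 0 < s + t by rewrite addr_gt0.
rewrite mulrACA [RHS]mulrACA -!expRD -!invfM -!sqrtrM.
- congr (expR _ / Num.sqrt _); field; rewrite ?gt_eqF//.
- by rewrite !mulr_ge0// ?pi_ge0// ltW.
- by rewrite !mulr_ge0// ?pi_ge0// ltW.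
Qed.

Lemma Gauss_convolution s t y z : 0 < s -> 0 < t ->
  (\int[mu]_x (Gauss s (z - x) * Gauss t (x - y))%:E = (Gauss (s + t) (z - y))%:E)%E.
Proof.
move=> s0 t0; under eq_integral do rewrite Gauss_mul// EFinM.
rewrite ge0_integralZl_EFin//; last exact: Gauss_ge0.
- by rewrite integral_Gauss ?mule1// divr_gt0 ?mulr_gt0 ?addr_gt0.
- by move=> x _; rewrite lee_fin Gauss_ge0.
- apply/measurable_EFinP; apply: measurableT_comp; first exact: measurable_Gauss.
  exact: measurable_funB.
Qed.

(** The kernel is centred at [y]; for the even kernels used below this is the usual convolution.
    Extended real values make it meaningful for every nonnegative measurable [f]. *)
Definition convol k f y : \bar R := (\int[mu]_x (f x * (k (x - y)%R)%:E))%E.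

Section Convolution.
Variable k : R -> R.
Hypothesis mk : measurable_fun [set: R] k.
Hypothesis k0 : forall x, 0 <= k x.

Lemma measurable_ker y : measurable_fun [set: R] (fun x => (k (x - y))%:E).
Proof. by apply/measurable_EFinP; apply: measurableT_comp => //; exact: measurable_funB. Qed.

Lemma measurable_convol_integrand f y : measurable_fun [set: R] f ->
  measurable_fun [set: R] (fun x => f x * (k (x - y))%:E)%E.
Proof. by move=> mf; apply: emeasurable_funM => //; exact: measurable_ker. Qed.

Lemma convol_ge0 f y : (forall x, 0 <= f x)%E -> (0 <= convol k f y)%E.
Proof. by move=> f0; apply: integral_ge0 => x _; rewrite mule_ge0// lee_fin. Qed.

Lemma le_convol f g y : measurable_fun [set: R] f -> measurable_fun setT g ->
  (forall x, 0 <= f x)%E -> (forall x, f x <= g x)%E ->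
  (convol k f y <= convol k g y)%E.
Proof.
move=> mf mg f0 fg; apply: ge0_le_integral => //=.
- by move=> x _; rewrite mule_ge0// lee_fin.
- exact: measurable_convol_integrand.
- exact: measurable_convol_integrand.
- by move=> x _; rewrite lee_wpmul2r// lee_fin.
Qed.

Lemma convol_shift f y : measurable_fun [set: R] f -> (forall x, 0 <= f x)%E ->
  convol k f y = (\int[mu]_x (f (x + y)%R * (k x)%:E))%E.
Proof.
move=> mf f0; rewrite /convol -(ge0_integral_shift y) //.
- by under eq_integral do rewrite addrK.
- exact: measurable_convol_integrand.
- by move=> x; rewrite mule_ge0// lee_fin.
Qed.

Lemma convol_periodic f a y : measurable_fun [set: R] f -> (forall x, 0 <= f x)%E ->
  (forall x, f (x + a)%R = f x) -> convol k f (y + a) = convol k f y.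
Proof.
move=> mf f0 fa; rewrite !convol_shift//.
by under eq_integral do rewrite addrA fa.
Qed.

Lemma measurable_convol2 f : measurable_fun [set: R] f ->
  measurable_fun setT (fun z : R * R => f z.1 * (k (z.1 - z.2))%:E)%E.
Proof.
move=> mf; apply: emeasurable_funM; first exact: measurableT_comp.
apply/measurable_EFinP; apply: (measurableT_comp mk).
by apply: measurable_funB; [exact: measurable_fst|exact: measurable_snd].
Qed.

Lemma measurable_convol f : measurable_fun [set: R] f -> (forall x, 0 <= f x)%E ->
  measurable_fun [set: R] (convol k f).
Proof.
move=> mf f0.
apply: (measurable_fun_fubini_tonelli_G (m1 := mu)
  (fun z : measurableTypeR R * measurableTypeR R => f z.1 * (k (z.1 - z.2)%R)%:E)%E).
  exact: measurable_convol2.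
by move=> x; rewrite mule_ge0// lee_fin.
Qed.

Lemma convol_even f y : (forall x, k (- x) = k x) ->
  measurable_fun [set: R] f -> (forall x, 0 <= f x)%E ->
  (forall x, f (- x)%R = f x) -> convol k f (- y) = convol k f y.
Proof.
move=> kN mf f0 fN; rewrite /convol -ge0_integralN//.
- by under eq_integral => x _ do rewrite fN -opprD kN.
- exact: measurable_convol_integrand.
- by move=> x; rewrite mule_ge0// lee_fin.
Qed.

End Convolution.

Lemma convol_convol k l f y : measurable_fun [set: R] k -> measurable_fun setT l ->
  measurable_fun [set: R] f -> (forall x, 0 <= k x) -> (forall x, 0 <= l x) ->
  (forall x, 0 <= f x)%E ->
  (convol l (convol k f) y =
   \int[mu]_z (f z * \int[mu]_x (k (z - x) * l (x - y))%:E))%E.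
Proof.
move=> mk ml mf k0 l0 f0; rewrite {1}/convol.
transitivity (\int[mu]_x \int[mu]_z ((f z * (k (z - x))%:E) * (l (x - y))%:E))%E.
  apply: eq_integral => x _; rewrite ge0_integralZr//.
  - exact: measurable_convol_integrand.
  - by move=> z _; rewrite mule_ge0// lee_fin.
  - by rewrite lee_fin.
rewrite (fubini_tonelli (m1 := mu) (m2 := mu) (fun z : measurableTypeR R * measurableTypeR R =>
  (f z.2 * (k (z.2 - z.1))%:E * (l (z.1 - y))%:E)%E)).
- apply: eq_integral => z _.
  under eq_integral do rewrite -muleA -EFinM.
  rewrite /= ge0_integralZl//=.
  + apply/measurable_EFinP; apply: measurable_funM; apply: measurableT_comp => //;
    exact: measurable_funB.
  + by move=> x _; rewrite lee_fin mulr_ge0.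
- apply: emeasurable_funM.
    have -> : (fun z : R * R => f z.2 * (k (z.2 - z.1))%:E)%E =
      (fun z : R * R => f z.1 * (k (z.1 - z.2))%:E)%E \o (fun p => (p.2, p.1)) by [].
    apply: measurableT_comp; first exact: measurable_convol2.
    exact: measurable_swap.
  apply: (measurableT_comp (measurable_ker ml y)); exact: measurable_fst.
- by move=> z; rewrite !mule_ge0// lee_fin.
Qed.

Lemma heat_semigroup s t f y : 0 < s -> 0 < t ->
  measurable_fun [set: R] f -> (forall x, 0 <= f x)%E ->
  convol (Gauss t) (convol (Gauss s) f) y = convol (Gauss (s + t)) f y.
Proof.
move=> s0 t0 mf f0.
rewrite convol_convol//; [|exact: measurable_Gauss|exact: measurable_Gauss|exact: Gauss_ge0|exact: Gauss_ge0].
by apply: eq_integral => z _; rewrite Gauss_convolution.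
Qed.

Lemma convol_cst1 t y : 0 < t -> convol (Gauss t) (cst 1%E) y = 1%E.
Proof.
move=> t0; rewrite /convol; under eq_integral do rewrite mul1e.
exact: integral_Gauss.
Qed.

Lemma convol_le1 t f y : 0 < t -> measurable_fun [set: R] f ->
  (forall x, 0 <= f x)%E -> (forall x, f x <= 1)%E -> (convol (Gauss t) f y <= 1)%E.
Proof.
move=> t0 mf f0 f1; rewrite -(convol_cst1 y t0).
by apply: le_convol => //; [exact: measurable_Gauss|exact: Gauss_ge0].
Qed.

End GaussianConvolution.

(** * Unfolding the sum over images *)

Section Images.
Context {R : realType}.
Local Notation mu := (@lebesgue_measure R).
Implicit Types (f g : R -> \bar R) (t x y z : R) (n : nat).

Lemma ge0_integral_itv_shift g (a : R) : measurable_fun [set: R] g ->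
  (forall x, 0 <= g x)%E ->
  (\int[mu]_(x in `[0%R, 1%R]) g (x + a)%R = \int[mu]_(x in `[a, (a + 1)%R]) g x)%E.
Proof.
move=> mg g0; rewrite integral_mkcond [RHS]integral_mkcond.
rewrite -[RHS](ge0_integral_shift a); first last.
- by move=> x; exact: erestrict_ge0.
- by apply/(measurable_restrictT _ _).1 => //; exact: measurable_funTS.
apply: eq_integral => x _; rewrite !patchE; congr (if _ then _ else _).
by apply/idP/idP; rewrite !inE/= !in_itv/= => /andP[? ?]; apply/andP; split; lra.
Qed.

Lemma ge0_integral_itv_reflect g (a : R) : measurable_fun [set: R] g ->
  (forall x, 0 <= g x)%E ->
  (\int[mu]_(x in `[0%R, 1%R]) g (a + 1 - x)%R = \int[mu]_(x in `[a, (a + 1)%R]) g x)%E.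
Proof.
move=> mg g0.
have mgN : measurable_fun [set: R] (g \o -%R) by exact: measurableT_comp.
have := @ge0_integral_itv_shift (g \o -%R) (- a - 1) mgN (fun x => g0 (- x)).
under eq_integral do rewrite /= !opprD !opprK addrC.
move=> ->; rewrite integral_mkcond [RHS]integral_mkcond -[RHS]ge0_integralN; first last.
- by move=> x; exact: erestrict_ge0.
- by apply/(measurable_restrictT _ _).1 => //; exact: measurable_funTS.
apply: eq_integral => x _; rewrite !patchE; congr (if _ then _ else _).
by apply/idP/idP; rewrite !inE/= !in_itv/= => /andP[? ?]; apply/andP; split; lra.
Qed.

(** The left-hand interval is half-open so that consecutive blocks are disjoint; the closed
    intervals on the right only add null endpoints. *)
Lemma ge0_integral_itvD g (a b c : R) : measurable_fun [set: R] g ->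
  (forall x, 0 <= g x)%E -> a <= b -> b <= c ->
  (\int[mu]_(x in `[a, c[) g x =
   \int[mu]_(x in `[a, b]) g x + \int[mu]_(x in `[b, c]) g x)%E.
Proof.
move=> mg g0 ab bc.
have -> : `[a, c[%classic = `[a, b[%classic `|` `[b, c[%classic.
  by rewrite -itv_bndbnd_setU// bnd_simp.
rewrite ge0_integral_setU//.
- by rewrite !integral_itv_bndo_bndc//; exact: measurable_funTS.
- exact: measurable_funTS.
- rewrite disj_set2E; apply/eqP/seteqP; split=> x //=; rewrite !in_itv/=.
  by case=> /andP[_ xb] /andP[]; rewrite leNgt xb.
Qed.

Lemma ge0_integral_halfline g : measurable_fun [set: R] g ->
  (forall x, 0 <= g x)%E ->
  (\int[mu]_(x in `[0%R, +oo[) g x =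
   \sum_(n <oo) (\int[mu]_(x in `[(n.*2)%:R, ((n.*2)%:R + 1)%R]) g x +
                 \int[mu]_(x in `[(n.*2.+1)%:R, ((n.*2.+1)%:R + 1)%R]) g x))%E.
Proof.
move=> mg g0.
pose B n := `[(n.*2%:R : R), n.*2%:R + 2[%classic.
(* The block containing [x] is the one numbered by the integer part of [x / 2]; this yields both the
   covering and the disjointness. *)
have inB n x : B n x -> n = Num.truncn (x / 2).
  rewrite /B/= in_itv/= => /andP[nx xn]; apply/esym/truncn_def.
  rewrite ler_pdivlMr// ltr_pdivrMr// -!natrM !muln2 nx/= (lt_le_trans xn)//.
  by rewrite doubleS -(addn2 _.*2) natrD.
have -> : `[0%R, +oo[%classic = \bigcup_n B n.
  apply/seteqP; split=> x /=; rewrite in_itv/= andbT.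
    move=> x0; exists (Num.truncn (x / 2)) => //; rewrite /B/= in_itv/=.
    have := @truncn_itv _ (x / 2) (divr_ge0 x0 (ler0n _ 2)).
    rewrite ler_pdivlMr// ltr_pdivrMr// -!natrM !muln2 => /andP[-> /lt_le_trans->]//.
    by rewrite doubleS -(addn2 _.*2) natrD.
  by case=> n _; rewrite /B/= in_itv/= => /andP[+ _]; exact: le_trans.
rewrite ge0_integral_bigcup//.
- apply: eq_eseriesr => n _; rewrite (@ge0_integral_itvD _ _ (n.*2%:R + 1))//; [|lra|lra].
  rewrite -(addn1 n.*2) natrD.
  by have -> : n.*2%:R + 1 + 1 = n.*2%:R + 2 :> R by lra.
- by move=> n; exact: measurable_itv.
- exact: measurable_funTS.
- by move=> i k _ _ [x [/inB -> /inB ->]].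
Qed.

Lemma ge0_integral_halflines g : measurable_fun [set: R] g ->
  (forall x, 0 <= g x)%E ->
  (\int[mu]_x g x = \int[mu]_(x in `[0%R, +oo[) g x +
                    \int[mu]_(x in `[0%R, +oo[) (g \o -%R) x)%E.
Proof.
move=> mg g0.
transitivity (\int[mu]_(x in (`]-oo, 0%R]%classic : set R) `|` `]0%R, +oo[%classic) g x)%E.
  congr (integral _ _ _); apply/seteqP; split=> x //= _.
  by rewrite !in_itv/= andbT; case: (leP x 0); [left|right].
rewrite ge0_integral_setU//; first last.
- rewrite disj_set2E; apply/eqP/seteqP; split=> x //=; rewrite !in_itv/= andbT.
  by case=> x0; rewrite ltNge x0.
- exact: measurable_funTS.
rewrite integral_itv_obnd_cbnd; last exact: measurable_funTS.
rewrite addeC; congr (_ + _)%E; apply/esym.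
have mgN : measurable_fun [set: R] (g \o -%R) by exact: measurableT_comp.
rewrite (ge0_integration_by_substitution0 mgN (fun x => g0 (- x))).
by apply: eq_integral => x _ /=; rewrite opprK.
Qed.

(** The summand of [Gneum], kept in the same form so that [Gneum] folds to the limit of its
    series. *)
Definition images t x y n : R :=
  Gauss t (x - (y + 2 * n%:R)) + Gauss t (x - (2 * n%:R - y))
  + Gauss t (x - (y - 2 * n.+1%:R)) + Gauss t (x - (- 2 * n.+1%:R - y)).

Lemma images_ge0 t x y n : 0 <= images t x y n.
Proof. by rewrite !addr_ge0// Gauss_ge0. Qed.

Lemma measurable_images t n :
  measurable_fun [set: R * R] (fun p : R * R => images t p.1 p.2 n).
Proof.
rewrite /images.
have m1 : measurable_fun [set: R * R] (fst : R * R -> R) by exact: measurable_fst.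
have m2 : measurable_fun [set: R * R] (snd : R * R -> R) by exact: measurable_snd.
repeat apply: measurable_funD; apply: (measurableT_comp (measurable_Gauss t));
  apply: measurable_funB => //.
- exact: measurable_funD.
- exact: measurable_funB.
- exact: measurable_funB.
- exact: measurable_funB.
Qed.

(** The Neumann kernel as an extended real: a sum of nonnegative terms is defined and measurable on
    the whole plane, so Tonelli applies without any discussion of convergence. *)
Definition image_sum t x y : \bar R := (\sum_(n <oo) (images t x y n)%:E)%E.

Lemma image_sum_ge0 t x y : (0 <= image_sum t x y)%E.
Proof. by apply: nneseries_ge0 => n _ _; rewrite lee_fin images_ge0. Qed.

Lemma measurable_image_sum t :
  measurable_fun [set: R * R] (fun p : R * R => image_sum t p.1 p.2).
Proof.
apply: ge0_emeasurable_sum.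
- by move=> n p _ _; rewrite lee_fin images_ge0.
- by move=> n _; apply/measurable_EFinP; exact: measurable_images.
Qed.

(* The left-hand side is the order in which [Gneum] lists the images, the right-hand
   side the order along the two half-lines. *)
Lemma nneseries_zigzag (P N : nat -> \bar R) :
  (forall n, 0 <= P n)%E -> (forall n, 0 <= N n)%E ->
  (\sum_(n <oo) ((if n is m.+1 then N m.*2.+1 else P 0%N) +
     (if n is m.+1 then P m.*2.+1 else N 0%N) + P n.+1.*2 + N n.+1.*2) =
   \sum_(n <oo) (P n.*2 + P n.*2.+1) + \sum_(n <oo) (N n.*2 + N n.*2.+1))%E.
Proof.
move=> P0 N0.
pose A n := if n is m.+1 then N m.*2.+1 else P 0%N.
pose B n := if n is m.+1 then P m.*2.+1 else N 0%N.
have A0 n : (0 <= A n)%E by case: n => [|n]; [exact: P0|exact: N0].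
have B0 n : (0 <= B n)%E by case: n => [|n]; [exact: N0|exact: P0].
have recl (u : nat -> \bar R) : (forall n, 0 <= u n)%E ->
    (\sum_(n <oo) u n = u 0%N + \sum_(n <oo) u n.+1)%E.
  move=> u0; rewrite nneseries_recl// -nneseries_addn//.
  by under [in RHS]eq_eseriesr do rewrite -addn1.
rewrite -/A -/B !nneseriesD; try by (move=> n _ _; rewrite ?adde_ge0 ?A0 ?B0 ?P0 ?N0).
rewrite (recl A)// (recl B)// (recl (fun n => P n.*2))// (recl (fun n => N n.*2))//=.
rewrite -!addeA; congr (_ + _)%E.
by rewrite addeC -!addeA [LHS]addeCA [X in (_ + X = _)%E]addeCA [LHS]addeCA.
Qed.

(** Unfolding: as [f] is invariant under the reflections, moving an image of [y] back to [y] moves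
    [[0, 1]] to another unit interval with integer endpoints without changing the values of [f].
    These intervals tile the line. *)
Lemma integral_image_sum t f y : measurable_fun [set: R] f ->
  (forall x, f x \is a fin_num) ->
  (forall x, 0 <= f x)%E -> (forall x, f (- x)%R = f x) ->
  (forall x, f (x + 2)%R = f x) ->
  (\int[mu]_(x in `[0%R, 1%R]) (f x * image_sum t x y) = convol (Gauss t) f y)%E.
Proof.
move=> mf ffin f0 fN f2.
have f2n n x : f (x + 2 * n%:R) = f x.
  elim: n => [|n IH]; first by rewrite mulr0 addr0.
  by rewrite -[n.+1]addn1 natrD mulrDr mulr1 addrA f2.
have fB2n n x : f (x - 2 * n%:R) = f x by rewrite -(f2n n) subrK.
have f2nB n x : f (2 * n%:R - x) = f x by rewrite addrC f2n fN.
pose g x := (f x * (Gauss t (x - y))%:E)%E.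
have mg : measurable_fun [set: R] g.
  by apply: measurable_convol_integrand => //; exact: measurable_Gauss.
have g0 x : (0 <= g x)%E by rewrite mule_ge0// lee_fin Gauss_ge0.
have mgN : measurable_fun [set: R] (g \o -%R) by exact: measurableT_comp.
have gN0 x : (0 <= (g \o -%R) x)%E by exact: g0.
pose P (m : nat) := (\int[mu]_(x in `[m%:R, (m%:R + 1)%R]) g x)%E.
pose N (m : nat) := (\int[mu]_(x in `[m%:R, (m%:R + 1)%R]) (g \o -%R) x)%E.
have P0 m : (0 <= P m)%E by apply: integral_ge0.
have N0 m : (0 <= N m)%E by apply: integral_ge0.
(* The point [x - 2 n] runs over [[- 2 n, 1 - 2 n]], and [2 n - x] over [[2 n - 1, 2 n]]. For
   [n = m.+1] these are the odd intervals numbered [2 m + 1] on the negative and the positive side;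
   for [n = 0] they are [[0, 1]] and [[-1, 0]]. *)
pose A n := if n is m.+1 then N m.*2.+1 else P 0%N.
pose B n := if n is m.+1 then P m.*2.+1 else N 0%N.
have A0 n : (0 <= A n)%E by case: n => [|n]; [exact: P0|exact: N0].
have B0 n : (0 <= B n)%E by case: n => [|n]; [exact: N0|exact: P0].
have mS h : measurable_fun [set: R] h -> measurable_fun (`[0%R, 1%R]%classic : set R) (fun x => g (h x)).
  by move=> mh; apply: measurable_funTS; exact: (measurableT_comp mg mh).
have intE n : (\int[mu]_(x in `[0%R, 1%R]) (f x * (images t x y n)%:E) =
   A n + B n + P n.+1.*2 + N n.+1.*2)%E.
  transitivity (\int[mu]_(x in `[0%R, 1%R]) (g (x - 2 * n%:R)%R + g (2 * n%:R - x)%R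
     + g (x + 2 * n.+1%:R)%R + g (- (x + 2 * n.+1%:R)%R)%R))%E.
    apply: eq_integral => x _; rewrite /g f2nB fN f2n fB2n /images.
    rewrite !EFinD !ge0_muleDr ?adde_ge0 ?lee_fin ?Gauss_ge0//.
    have -> : x - (y + 2 * n%:R) = x - 2 * n%:R - y by lra.
    have -> : x - (2 * n%:R - y) = - (2 * n%:R - x - y) by lra.
    have -> : x - (y - 2 * n.+1%:R) = x + 2 * n.+1%:R - y by lra.
    have -> : x - (- 2 * n.+1%:R - y) = - (- (x + 2 * n.+1%:R) - y) by lra.
    by rewrite !GaussN.
  have mS1 a : measurable_fun (`[0%R, 1%R]%classic : set R) (fun x => g (x + a)).
    by apply: mS; exact: measurable_funD.
  have mS2 a : measurable_fun (`[0%R, 1%R]%classic : set R) (fun x => g (a - x)).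
    by apply: mS; exact: measurable_funB.
  have mS3 a : measurable_fun (`[0%R, 1%R]%classic : set R) (fun x => g (- (x + a))).
    by apply: mS; apply: measurableT_comp => //; exact: measurable_funD.
  rewrite ge0_integralD; [|by []|by move=> *; rewrite !adde_ge0| |by move=> *; exact: g0|exact: mS3]; last first.
    apply: emeasurable_funD; [apply: emeasurable_funD; [exact: mS1|exact: mS2]|exact: mS1].
  rewrite ge0_integralD; [|by []|by move=> *; rewrite !adde_ge0| |by move=> *; exact: g0|exact: mS1]; last first.
    by apply: emeasurable_funD; [exact: mS1|exact: mS2].
  rewrite ge0_integralD; [|by []|by move=> *; exact: g0|exact: mS1|by move=> *; exact: g0|exact: mS2].
  have e2 m : 2 * m%:R = m.*2%:R :> R by rewrite -natrM mul2n.
  have sP m := ge0_integral_itv_shift m%:R mg g0.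
  have sN m := ge0_integral_itv_shift m%:R mgN gN0.
  have rP m := ge0_integral_itv_reflect m%:R mg g0.
  have rN m := ge0_integral_itv_reflect m%:R mgN gN0.
  have dS m : m.+1.*2%:R = m.*2.+1%:R + 1 :> R by rewrite doubleS -[m.*2.+2]addn1 natrD.
  have aE : (\int[mu]_(x in `[0%R, 1%R]) g (x - 2 * n%:R)%R = A n)%E.
    rewrite e2; case: (n) => [|m].
      transitivity (\int[mu]_(x in `[0%R, 1%R]) g (x + 0%:R)%R)%E; last exact: (sP 0%N).
      by apply: eq_integral => x _; rewrite double0 mulr0n subr0 addr0.
    transitivity (\int[mu]_(x in `[0%R, 1%R]) (g \o -%R) (m.*2.+1%:R + 1 - x)%R)%E.
      by apply: eq_integral => x _; rewrite /= -dS opprB.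
    exact: (rN m.*2.+1).
  have bE : (\int[mu]_(x in `[0%R, 1%R]) g (2 * n%:R - x)%R = B n)%E.
    rewrite e2; case: (n) => [|m].
      transitivity (\int[mu]_(x in `[0%R, 1%R]) (g \o -%R) (x + 0%:R)%R)%E; last exact: (sN 0%N).
      by apply: eq_integral => x _; rewrite /= double0 mulr0n sub0r addr0.
    transitivity (\int[mu]_(x in `[0%R, 1%R]) g (m.*2.+1%:R + 1 - x)%R)%E.
      by apply: eq_integral => x _; rewrite dS.
    exact: (rP m.*2.+1).
  have cE : (\int[mu]_(x in `[0%R, 1%R]) g (x + 2 * n.+1%:R)%R = P n.+1.*2)%E.
    by rewrite e2; exact: sP.
  have dE : (\int[mu]_(x in `[0%R, 1%R]) g (- (x + 2 * n.+1%:R))%R = N n.+1.*2)%E.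
    by rewrite e2; exact: sN.
  by rewrite aE bE cE dE.
transitivity (\sum_(n <oo) (A n + B n + P n.+1.*2 + N n.+1.*2))%E.
  transitivity (\int[mu]_(x in `[0%R, 1%R]) \sum_(n <oo) (f x * (images t x y n)%:E))%E.
    apply: eq_integral => x _; rewrite -(fineK (ffin x)) nneseriesZl// => n _.
    by rewrite lee_fin images_ge0.
  rewrite integral_nneseries//.
  - by apply: eq_eseriesr => n _; exact: intE.
  - move=> n; apply: emeasurable_funM; first exact: measurable_funTS.
    apply/measurable_EFinP; apply: measurable_funTS.
    exact: (measurableT_comp (measurable_images t n) (pair2_measurable y)).
  - by move=> n x _; rewrite mule_ge0// lee_fin images_ge0.
apply: etrans; first exact: (nneseries_zigzag P0 N0).
rewrite /convol -/g (ge0_integral_halflines mg g0).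
by rewrite (ge0_integral_halfline mg g0) (ge0_integral_halfline mgN gN0).
Qed.

End Images.

(** * Convergence of the image series and a uniform bound for the Neumann kernel *)

Section ImageSum.
Context {R : realType}.
Implicit Types (t x y z : R) (n : nat).

(** The hypothesis gives [z ^+ 2 >= n - 1], so the quadratic exponent may be replaced by a linear
    one. The distance [2 (n - 1)] is that of the closest image in the [n]-th group, [2 n - y] at
    [x = y = 1]. *)
Lemma Gauss_le_geometric t z n : 0 < t -> 2 * (n%:R - 1) <= `|z| ->
  Gauss t z <= geometric (expR (2 * t)^-1 / Num.sqrt (2 * pi * t)) (expR (- (2 * t)^-1)) n.
Proof.
move=> t0 nz; rewrite /geometric/= /Gauss [leRHS]mulrAC ler_wpM2r ?invr_ge0 ?sqrtr_ge0//.
rewrite -expRM_natl -expRD ler_expR.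
have t20 : 0 < (2 * t)^-1 by rewrite invr_gt0 mulr_gt0.
suff : n%:R - 1 <= z ^+ 2.
  rewrite -(ler_pM2r t20) mulrBl mul1r -subr_ge0 => nz2.
  by rewrite -subr_ge0; apply: le_trans nz2 _; rewrite le_eqVlt; apply/orP; left; apply/eqP; ring.
case: n nz => [_|n]; first by have := sqr_ge0 z; lra.
rewrite -[n.+1]addn1 natrD addrK => nz.
have n0 : 0 <= n%:R :> R by [].
have : (2 * n%:R) ^+ 2 <= `|z| ^+ 2 by rewrite lerXn2r// nnegrE ?mulr_ge0.
rewrite real_normK ?num_real//; apply: le_trans.
have : n%:R <= n%:R ^+ 2 :> R by rewrite -natrX ler_nat -mulnn; case: (n) => // m; exact: leq_pmulr.
nra.
Qed.

(** The factor 4 counts the images in each summand. *)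
Definition image_bound t :=
  4 * (expR (2 * t)^-1 / Num.sqrt (2 * pi * t)).

Lemma images_le_geometric t x y n : 0 < t -> 0 <= x <= 1 -> 0 <= y <= 1 ->
  images t x y n <= geometric (image_bound t) (expR (- (2 * t)^-1)) n.
Proof.
move=> t0 /andP[x0 x1] /andP[y0 y1]; rewrite /geometric/= /image_bound /images.
have n0 : 0 <= n%:R :> R by [].
set b := (X in _ <= _ * X * _).
have le z : 2 * (n%:R - 1) <= `|z| -> Gauss t z <= b * expR (- (2 * t)^-1) ^+ n.
  exact: Gauss_le_geometric.
have nS : n.+1%:R = n%:R + 1 :> R by rewrite -addn1 natrD.
have -> : 4 * b * expR (- (2 * t)^-1) ^+ n = b * expR (- (2 * t)^-1) ^+ n +
  b * expR (- (2 * t)^-1) ^+ n + b * expR (- (2 * t)^-1) ^+ n + b * expR (- (2 * t)^-1) ^+ n by ring.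
rewrite !lerD// le// ?nS.
- by rewrite -normrN; apply: le_trans (ler_norm _); lra.
- by rewrite -normrN; apply: le_trans (ler_norm _); lra.
- by apply: le_trans (ler_norm _); lra.
- by apply: le_trans (ler_norm _); lra.
Qed.

Lemma image_bound_ge0 t : 0 <= image_bound t.
Proof. by rewrite mulr_ge0// divr_ge0 ?expR_ge0 ?sqrtr_ge0. Qed.

Lemma is_cvg_images t x y : 0 < t -> 0 <= x <= 1 -> 0 <= y <= 1 ->
  cvgn (series (images t x y)).
Proof.
move=> t0 x01 y01; apply: (series_le_cvg (v_ := geometric (image_bound t) (expR (- (2 * t)^-1)))).
- exact: images_ge0.
- by move=> n; rewrite /geometric/= mulr_ge0 ?image_bound_ge0// exprn_ge0// expR_ge0.
- by move=> n; exact: images_le_geometric.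
- apply: is_cvg_geometric_series.
  by rewrite ger0_norm ?expR_ge0// -expR0 ltr_expR oppr_lt0 invr_gt0 mulr_gt0.
Qed.

Lemma Gneum_image_sum t x y : 0 < t -> 0 <= x <= 1 -> 0 <= y <= 1 ->
  (Gneum t x y)%:E = image_sum t x y.
Proof.
move=> t0 x01 y01; rewrite /Gneum -/(images t x y) -EFin_lim; last exact: is_cvg_images.
rewrite /image_sum; congr (limn _); apply/funext => n /=.
by rewrite /series/= -sumEFin.
Qed.

Lemma Gneum_le t x y : 0 < t -> 0 <= x <= 1 -> 0 <= y <= 1 ->
  Gneum t x y <= image_bound t * (1 - expR (- (2 * t)^-1))^-1.
Proof.
move=> t0 x01 y01.
have q1 : `|expR (- (2 * t)^-1)| < 1.
  by rewrite ger0_norm ?expR_ge0// -expR0 ltr_expR oppr_lt0 invr_gt0 mulr_gt0.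
rewrite -(cvg_lim _ (cvg_geometric_series q1))//.
apply: ler_lim.
- exact: is_cvg_images.
- exact: is_cvg_geometric_series.
- by apply: nearW => n; rewrite /series/= ler_sum// => i _; exact: images_le_geometric.
Qed.

End ImageSum.

(** * The heat flow preserves monotonicity *)

Section Monotonicity.
Context {R : realType}.
Local Notation mu := (@lebesgue_measure R).
Implicit Types (f g : R -> \bar R) (t x y z : R) (n : nat).

(** The test functions: functions on [[0, 1]] extended to the line by the reflections. The bound 1
    limits both the cost of truncating a kernel and the effect of moving mass. *)
Record reflected f : Prop := Reflected {
  refl_meas : measurable_fun [set: R] f;
  refl_ge0 : forall x, (0 <= f x)%E;
  refl_le1 : forall x, (f x <= 1)%E;
  reflN : forall x, f (- x)%R = f x;
  refl2 : forall x, f (x + 2)%R = f x }.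

Definition nondecreasing01 f :=
  forall x y, 0 <= x -> x <= y -> y <= 1 -> (f x <= f y)%E.

Lemma refl_fin f x : reflected f -> f x \is a fin_num.
Proof.
by move=> rf; rewrite ge0_fin_numE ?refl_ge0// (le_lt_trans (refl_le1 rf x))// ltry.
Qed.

(** Folded onto [[0, 1]], the two points become [|c - s|] and the smaller of [c + s] and
    [2 - c - s]; the first is at most the second because [c] and [s] lie in [[0, 1]]. *)
Lemma nondecreasing01_fold f c s : reflected f -> nondecreasing01 f ->
  0 <= c <= 1 -> 0 <= s <= 1 -> (f (c - s)%R <= f (c + s)%R)%E.
Proof.
move=> rf nf /andP[c0 c1] /andP[s0 s1].
have -> : f (c - s) = f `|c - s|.
  by case: (ger0P (c - s)) => // _; rewrite reflN.
have [cs1|cs1] := leP (c + s) 1.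
  by apply: nf => //; case: (ger0P (c - s)) => ?; lra.
rewrite -(reflN rf (c + s)) -(refl2 rf (- (c + s))).
by apply: nf; case: (ger0P (c - s)) => ?; lra.
Qed.

Lemma convol_Gauss_reflected t f : 0 < t -> reflected f -> reflected (convol (Gauss t) f).
Proof.
move=> t0 [mf f0 f1 fN f2]; split.
- by apply: measurable_convol => //; [exact: measurable_Gauss|exact: Gauss_ge0].
- by move=> x; apply: convol_ge0 => //; exact: Gauss_ge0.
- by move=> x; exact: convol_le1.
- by move=> x; apply: convol_even => //; [exact: measurable_Gauss|exact: Gauss_ge0|exact: GaussN].
- by move=> x; apply: convol_periodic => //; [exact: measurable_Gauss|exact: Gauss_ge0].
Qed.

Section UnimodalKernel.
Variable k : R -> R.
Hypothesis mk : measurable_fun [set: R] k.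
Hypothesis k0 : forall x, 0 <= k x.
Hypothesis k_le : forall x y, `|x| <= `|y| -> k y <= k x.
Hypothesis k_supp : forall x, 1 / 2 < `|x| -> k x = 0.

(* Reflecting the integration variable about the midpoint c of x and y reduces the
   claim to a rearrangement inequality for f (c - s) <= f (c + s) against the weights
   k (s - e) >= k (s + e); the support condition restricts it to s <= 1. *)
Lemma convol_nondecreasing01 f : reflected f -> nondecreasing01 f ->
  nondecreasing01 (convol k f).
Proof.
move=> rf nf x y x0 xy y1; have [mf f0 f1 fN f2] := rf.
have kN z : k (- z) = k z by apply/eqP; rewrite eq_le !k_le// normrN.
pose c := (x + y) / 2; pose e := (y - x) / 2.
have mfc : measurable_fun [set: R] (fun s => f (s + c)).
  by apply: (measurableT_comp mf); exact: measurable_funD.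
have mK a : measurable_fun [set: R] (fun s => (k (s + a))%:E).
  apply/measurable_EFinP; apply: (measurableT_comp mk); exact: measurable_funD.
have mg a : measurable_fun [set: R] (fun s => f (s + c)%R * (k (s + a)%R)%:E)%E.
  by apply: emeasurable_funM.
have g0 a s : (0 <= f (s + c)%R * (k (s + a)%R)%:E)%E by rewrite mule_ge0// lee_fin.
have cE a : convol k f (c - a) = (\int[mu]_s (f (s + c)%R * (k (s + a)%R)%:E))%E.
  rewrite /convol.
  apply: etrans; last exact: (ge0_integral_shift (- c) (mg a) (g0 a)).
  by apply: eq_integral => s _; rewrite subrK opprB addrCA addrA; congr (_ * (k _)%:E)%E; ring.
have -> : x = c - e by rewrite /c /e; lra.
have -> : y = c - - e by rewrite /c /e; lra.
rewrite !cE (ge0_integral_halflines (mg e) (g0 e)) (ge0_integral_halflines (mg (- e)) (g0 (- e))).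
have mgN a : measurable_fun [set: R] ((fun s => f (s + c)%R * (k (s + a)%R)%:E)%E \o -%R).
  exact: measurableT_comp.
have gN0 a s : (0 <= ((fun s => f (s + c)%R * (k (s + a)%R)%:E)%E \o -%R) s)%E by exact: g0.
rewrite -!ge0_integralD//; try exact: measurable_funTS.
apply: ge0_le_integral => //.
- by move=> s _; rewrite adde_ge0.
- by apply: measurable_funTS; apply: emeasurable_funD; [exact: mg|exact: mgN].
- by apply: measurable_funTS; apply: emeasurable_funD; [exact: mg|exact: mgN].
move=> s /=; rewrite in_itv/= andbT => s0.
have e0 : 0 <= e <= 1 / 2 by rewrite /e; apply/andP; split; lra.
(* For [s > 1] all four kernel arguments have absolute value at least [s - e > 1 / 2], as
   [e <= 1 / 2]; hence the width allowed for the support. *)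
have [s1|s1] := leP s 1; last first.
  have ks a : 1 / 2 < a -> k a = 0.
    by move=> a2; apply: k_supp; apply: lt_le_trans a2 (ler_norm _).
  have ksN a : 1 / 2 < - a -> k a = 0 by rewrite -kN; exact: ks.
  have z1 : k (s + e) = 0 by apply: ks; lra.
  have z2 : k (- s + e) = 0 by apply: ksN; lra.
  have z3 : k (s - e) = 0 by apply: ks; lra.
  have z4 : k (- s - e) = 0 by apply: ksN; lra.
  by rewrite z1 z2 z3 z4 !mule0.
have -> : k (- s + e) = k (s - e) by rewrite -kN opprD opprK.
have -> : k (- s - e) = k (s + e) by rewrite -kN opprD !opprK.
have : (f (c - s)%R <= f (c + s)%R)%E.
  by apply: nondecreasing01_fold => //; [rewrite /c; apply/andP; split; lra|exact/andP].
have kk : k (s + e) <= k (s - e).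
  apply: k_le; rewrite (ger0_norm (_ : 0 <= s + e)); last lra.
  by case: (ger0P (s - e)) => _; lra.
rewrite (addrC s c) (addrC (- s) c).
rewrite -(fineK (refl_fin (c - s) rf)) -(fineK (refl_fin (c + s) rf)) -!EFinM -!EFinD !lee_fin.
(* The difference of the two sides is [(f (c + s) - f (c - s)) * (k (s - e) - k (s + e))]. *)
by nra.
all: by apply: measurable_funTS; (exact: mg || exact: mgN).
Qed.

End UnimodalKernel.

(** * Truncated Gaussian kernels and the error of truncation *)

Definition Gauss_trunc t z := if `|z| <= 1 / 2 then Gauss t z else 0.

Lemma Gauss_trunc_ge0 t z : 0 <= Gauss_trunc t z.
Proof. by rewrite /Gauss_trunc; case: ifP => // _; exact: Gauss_ge0. Qed.

(** The truncated kernel is not renormalised: its iterates stay below the heat flow, and the lost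
    mass becomes a one-sided error. *)
Lemma Gauss_trunc_le t z : Gauss_trunc t z <= Gauss t z.
Proof. by rewrite /Gauss_trunc; case: ifP => // _; exact: Gauss_ge0. Qed.

Lemma measurable_Gauss_trunc t : measurable_fun [set: R] (Gauss_trunc t).
Proof.
apply: measurable_fun_ifT => //; last exact: measurable_Gauss.
by apply: measurable_fun_ler => //; exact: measurableT_comp.
Qed.

Lemma Gauss_truncN t z : Gauss_trunc t (- z) = Gauss_trunc t z.
Proof. by rewrite /Gauss_trunc normrN GaussN. Qed.

Lemma Gauss_trunc_unimodal t x y : 0 < t -> `|x| <= `|y| ->
  Gauss_trunc t y <= Gauss_trunc t x.
Proof.
move=> t0 xy; rewrite /Gauss_trunc.
have [y2|y2] := leP `|y| (1 / 2); last by case: ifP => // _; exact: Gauss_ge0.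
rewrite (le_trans xy y2) /Gauss ler_wpM2r ?invr_ge0 ?sqrtr_ge0// ler_expR.
have t20 : 0 <= (2 * t)^-1 by rewrite invr_ge0 mulr_ge0// ltW.
rewrite ler_wpM2r// lerN2.
by rewrite -[x ^+ 2]real_normK ?num_real// -[y ^+ 2]real_normK ?num_real// lerXn2r ?nnegrE.
Qed.

Lemma Gauss_trunc_supp t x : 1 / 2 < `|x| -> Gauss_trunc t x = 0.
Proof. by move=> x2; rewrite /Gauss_trunc leNgt x2. Qed.

Lemma convol_trunc_reflected t f : 0 < t -> reflected f ->
  reflected (convol (Gauss_trunc t) f).
Proof.
move=> t0 rf; have [mf f0 f1 fN f2] := rf.
have mk := measurable_Gauss_trunc t; have k0 := Gauss_trunc_ge0 t.
split.
- exact: measurable_convol.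
- by move=> x; exact: convol_ge0.
- move=> x; apply: le_trans (refl_le1 (convol_Gauss_reflected t0 rf) x).
  apply: ge0_le_integral => //.
  + by move=> z _; rewrite mule_ge0// lee_fin.
  + exact: measurable_convol_integrand.
  + by apply: measurable_convol_integrand => //; exact: measurable_Gauss.
  + by move=> z _; rewrite lee_wpmul2l// lee_fin Gauss_trunc_le.
- by move=> x; apply: convol_even => //; exact: Gauss_truncN.
- by move=> x; exact: convol_periodic.
Qed.

Definition tail_bound t := 2 * expR (- (16 * t)^-1).

(** The exponent is split into two halves: for [|z| > 1 / 2] one half is at most [- 1 / (16 t)],
    while the other is that of a Gaussian of variance [2 t]. The normalisations differ by a factor
    [sqrt 2], bounded by the 2 of [tail_bound]. *)
Lemma Gauss_tail t z : 0 < t ->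
  Gauss t z <= Gauss_trunc t z + tail_bound t * Gauss (2 * t) z.
Proof.
move=> t0; rewrite /Gauss_trunc /tail_bound.
have [_|z2] := leP `|z| (1 / 2).
  by rewrite lerDl !mulr_ge0 ?expR_ge0// Gauss_ge0.
rewrite add0r mulrA /Gauss.
have t20 : 0 < (16 * t)^-1 by rewrite invr_gt0 mulr_gt0.
have s0 : 0 < Num.sqrt (2 * pi * t) by rewrite sqrtr_gt0 !mulr_gt0 ?pi_gt0.
have s1 : 0 < Num.sqrt (2 * pi * (2 * t)) by rewrite sqrtr_gt0 !mulr_gt0 ?pi_gt0.
have s01 : Num.sqrt (2 * pi * (2 * t)) <= 2 * Num.sqrt (2 * pi * t).
  have p0 := pi_gt0 R.
  rewrite -(ler_pXn2r (n := 2))// ?nnegrE ?mulr_ge0 ?sqrtr_ge0//.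
  rewrite exprMn !sqr_sqrtr; [nra|by rewrite !mulr_ge0// ?pi_ge0 ?ltW..].
have eE : expR (- z ^+ 2 / (2 * t)) <=
    expR (- (16 * t)^-1) * expR (- z ^+ 2 / (2 * (2 * t))).
  rewrite -expRD ler_expR -(ler_pM2r (_ : 0 < 16 * t)) ?mulr_gt0//.
  have z4 : 1 / 4 <= z ^+ 2 by rewrite -[z ^+ 2]real_normK ?num_real//; nra.
  have -> : - z ^+ 2 / (2 * t) * (16 * t) = - (8 * z ^+ 2) by field; rewrite gt_eqF.
  have -> : (- (16 * t)^-1 + - z ^+ 2 / (2 * (2 * t))) * (16 * t) = - 1 - 4 * z ^+ 2.
    by field; rewrite gt_eqF.
  lra.
apply: (@le_trans _ _ (expR (- (16 * t)^-1) * expR (- z ^+ 2 / (2 * (2 * t))) *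
  (2 / Num.sqrt (2 * pi * (2 * t))))).
  rewrite ler_pM ?expR_ge0 ?invr_ge0 ?sqrtr_ge0//.
  by rewrite ler_pdivlMr// mulrC ler_pdivrMr.
by rewrite le_eqVlt; apply/orP; left; apply/eqP; ring.
Qed.

(** Since [f <= 1] and the Gaussian of variance [2 t] dominating the tail has mass 1, the error is
    at most the constant in front of it. *)
Lemma convol_Gauss_trunc t f y : 0 < t -> reflected f ->
  (convol (Gauss t) f y <= convol (Gauss_trunc t) f y + (tail_bound t)%:E)%E.
Proof.
move=> t0 rf; have [mf f0 f1 fN f2] := rf.
have b0 : 0 <= tail_bound t by rewrite mulr_ge0 ?expR_ge0.
have t20 : 0 < 2 * t by rewrite mulr_gt0.
have mT : measurable_fun [set: R] (fun x => f x * (Gauss_trunc t (x - y)%R)%:E)%E.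
  by apply: measurable_convol_integrand => //; exact: measurable_Gauss_trunc.
have mG : measurable_fun [set: R] (fun x => (Gauss (2 * t) (x - y)%R)%:E)%E.
  by apply: measurable_ker; exact: measurable_Gauss.
have -> : (tail_bound t)%:E = (\int[mu]_x ((tail_bound t)%:E * (Gauss (2 * t) (x - y)%R)%:E))%E.
  rewrite ge0_integralZl_EFin//; first by rewrite integral_Gauss// mule1.
  by move=> x _; rewrite lee_fin Gauss_ge0.
rewrite /convol -ge0_integralD//; first last.
- exact: measurable_funeM.
- by move=> x _; rewrite mule_ge0// lee_fin// Gauss_ge0.
- by move=> x _; rewrite mule_ge0// lee_fin Gauss_trunc_ge0.
apply: ge0_le_integral => //.
- by move=> x _; rewrite mule_ge0// lee_fin Gauss_ge0.
- by apply: measurable_convol_integrand => //; exact: measurable_Gauss.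
- by apply: emeasurable_funD => //; exact: measurable_funeM.
move=> x _; rewrite -(fineK (refl_fin x rf)) -!EFinM -EFinD lee_fin.
have := Gauss_tail (x - y) t0; have := Gauss_ge0 (2 * t) (x - y).
have : 0 <= fine (f x) by rewrite fine_ge0.
have : fine (f x) <= 1 by rewrite -lee_fin fineK// refl_fin.
move: (fine _) (Gauss t _) (Gauss_trunc t _) (Gauss (2 * t) _) => a G T H a1 a0 H0 GT.
apply: le_trans (ler_wpM2l a0 GT) _; rewrite mulrDr lerD2l ler_piMl// mulr_ge0//.
Qed.

Lemma convol_Gauss_addc t f (c : R) y : 0 < t -> 0 <= c -> measurable_fun [set: R] f ->
  (forall x, 0 <= f x)%E ->
  convol (Gauss t) (fun x => f x + c%:E)%E y = (convol (Gauss t) f y + c%:E)%E.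
Proof.
move=> t0 c0 mf f0.
have mG : measurable_fun [set: R] (fun x => (Gauss t (x - y)%R)%:E)%E.
  by apply: measurable_ker; exact: measurable_Gauss.
have G0 x : (0 <= (Gauss t (x - y)%R)%:E)%E by rewrite lee_fin Gauss_ge0.
transitivity (\int[mu]_x (f x * (Gauss t (x - y)%R)%:E + c%:E * (Gauss t (x - y)%R)%:E))%E.
  by apply: eq_integral => x _; rewrite ge0_muleDl// lee_fin.
rewrite ge0_integralD//.
- by rewrite ge0_integralZl_EFin// integral_Gauss// mule1.
- by move=> x _; rewrite mule_ge0.
- exact: emeasurable_funM.
- by move=> x _; rewrite mule_ge0// lee_fin.
- exact: measurable_funeM.
Qed.

(** At least one factor is required: [Gauss 0] is the zero function by the convention for division
    by zero, not a Dirac mass. *)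
Lemma iter_heat t f n : 0 < t -> reflected f ->
  iter n.+1 (convol (Gauss t)) f = convol (Gauss (n.+1%:R * t)) f.
Proof.
move=> t0 rf; elim: n => [|n IH]; first by rewrite mul1r.
rewrite iterS IH; apply/funext => y; rewrite heat_semigroup//.
- by rewrite -[n.+2]addn1 natrD mulrDl mul1r.
- by rewrite mulr_gt0.
- exact: refl_meas.
- exact: refl_ge0.
Qed.

Lemma iter_trunc_reflected t f n : 0 < t -> reflected f ->
  reflected (iter n (convol (Gauss_trunc t)) f).
Proof.
by move=> t0 rf; elim: n => [//|n IH]; rewrite iterS; exact: convol_trunc_reflected.
Qed.

Lemma iter_trunc_nondecreasing01 t f n : 0 < t -> reflected f ->
  nondecreasing01 f -> nondecreasing01 (iter n (convol (Gauss_trunc t)) f).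
Proof.
move=> t0 rf nf; elim: n => [//|n IH]; rewrite iterS.
apply: convol_nondecreasing01 => //.
- exact: measurable_Gauss_trunc.
- exact: Gauss_trunc_ge0.
- by move=> x y; exact: Gauss_trunc_unimodal.
- exact: Gauss_trunc_supp.
- exact: iter_trunc_reflected.
Qed.

(** The errors add up without amplification, because the Gaussian has mass 1 and carries the error
    constant of the earlier steps through unchanged. *)
Lemma iter_heat_trunc t f n y : 0 < t -> reflected f ->
  (iter n (convol (Gauss_trunc t)) f y <= iter n (convol (Gauss t)) f y <=
   iter n (convol (Gauss_trunc t)) f y + (n%:R * tail_bound t)%:E)%E.
Proof.
move=> t0 rf; have b0 : 0 <= tail_bound t by rewrite mulr_ge0 ?expR_ge0.
elim: n y => [|n IH] y; first by rewrite /= mul0r adde0 lexx.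
have rP : reflected (iter n (convol (Gauss t)) f).
  by elim: n {IH} => [//|n IH]; rewrite iterS; exact: convol_Gauss_reflected.
have rQ : reflected (iter n (convol (Gauss_trunc t)) f) by exact: iter_trunc_reflected.
rewrite !iterS; apply/andP; split.
  apply: ge0_le_integral => //.
  - by move=> x _; rewrite mule_ge0// ?lee_fin ?Gauss_trunc_ge0// refl_ge0.
  - by apply: measurable_convol_integrand; [exact: measurable_Gauss_trunc|exact: refl_meas].
  - by apply: measurable_convol_integrand; [exact: measurable_Gauss|exact: refl_meas].
  - move=> x _; apply: lee_pmul; [exact: refl_ge0|by rewrite lee_fin Gauss_trunc_ge0| |by rewrite lee_fin Gauss_trunc_le].
    by have /andP[] := IH x.
have nb0 : 0 <= n%:R * tail_bound t by rewrite mulr_ge0.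
apply: (@le_trans _ _ (convol (Gauss t) (fun x => iter n (convol (Gauss_trunc t)) f x + (n%:R * tail_bound t)%:E)%E y)).
  apply: le_convol.
  - exact: measurable_Gauss.
  - exact: Gauss_ge0.
  - exact: refl_meas.
  - by apply: emeasurable_funD => //; exact: refl_meas.
  - by move=> x; exact: refl_ge0.
  - by move=> x; have /andP[] := IH x.
rewrite convol_Gauss_addc//; [|exact: refl_meas|exact: refl_ge0].
apply: (le_trans (leeD2r _ (convol_Gauss_trunc y t0 rQ))).
by rewrite -addeA -EFinD -natr1 mulrDl mul1r (addrC (tail_bound t)).
Qed.

(** With [a = m / (16 T)], the bound [expR a >= a ^+ 2 / 2] turns [2 m expR (- a)] into
    [4 m / a ^+ 2], and [1024 = 4 * 16 ^ 2]. *)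
Lemma tail_bound_scaled (T : R) n : 0 < T ->
  n.+1%:R * tail_bound (T / n.+1%:R) <= 1024 * T ^+ 2 / n.+1%:R.
Proof.
move=> T0; rewrite /tail_bound; set m : R := n.+1%:R.
have m0 : 0 < m by rewrite ltr0n.
pose a := m / (16 * T).
have a0 : 0 < a by rewrite divr_gt0 ?mulr_gt0.
have -> : (16 * (T / m))^-1 = a by rewrite /a; field; rewrite !gt_eqF.
have ea : a ^+ 2 / 2 <= expR a.
  have := expR_ge1Dxn 1 (ltW a0); rewrite (_ : 2`!%:R = 2 :> R)//; lra.
rewrite expRN.
apply: (@le_trans _ _ (m * (2 * (a ^+ 2 / 2)^-1))).
  by rewrite !ler_pM2l// lef_pV2// posrE ?expR_gt0// divr_gt0 ?exprn_gt0.
by rewrite le_eqVlt; apply/orP; left; apply/eqP; rewrite /a; field; rewrite !gt_eqF.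
Qed.

Lemma heat_nondecreasing01 (T : R) f : 0 < T -> reflected f ->
  nondecreasing01 f -> nondecreasing01 (convol (Gauss T) f).
Proof.
move=> T0 rf nf x y x0 xy y1.
have rP := convol_Gauss_reflected T0 rf.
rewrite -(fineK (refl_fin x rP)) -(fineK (refl_fin y rP)) lee_fin.
apply/ler_addgt0Pr => e e0.
pose n := Num.truncn (1024 * T ^+ 2 / e).
have ne : 1024 * T ^+ 2 / n.+1%:R <= e.
  rewrite ler_pdivrMr ?ltr0n// [leRHS]mulrC -ler_pdivrMr//; apply: ltW.
  exact: truncnS_gt.
rewrite -lee_fin EFinD (fineK (refl_fin x rP)) (fineK (refl_fin y rP)).
have t0 : 0 < T / n.+1%:R by rewrite divr_gt0 ?ltr0n.
have TE : n.+1%:R * (T / n.+1%:R) = T by rewrite mulrC divfK// pnatr_eq0.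
rewrite -{1 2}TE -(iter_heat n t0 rf).
have /andP[_ h1] := iter_heat_trunc n.+1 x t0 rf.
have /andP[h2 _] := iter_heat_trunc n.+1 y t0 rf.
apply: (le_trans h1); apply: leeD.
  by apply: le_trans h2; exact: iter_trunc_nondecreasing01.
by rewrite lee_fin; apply: le_trans ne; exact: tail_bound_scaled.
Qed.

End Monotonicity.

(** * Distribution functions of finite measures *)

Section States.
Context {R : realType}.
Local Notation mu := (@lebesgue_measure R).
Local Notation I01 := (`[0%R, 1%R]%classic : set R).
Implicit Types (u v w : umeas R) (f g h : R -> \bar R) (r s t x y : R).

(** Finite mass replaces boundedness of the density, since conservation of mass transfers it
    directly through [G]. *)
Record finite_pos u : Prop := FinitePos {
  fp_meas : measurable_fun I01 (rho_of u);
  fp_rho : forall x, 0 <= x <= 1 -> 0 <= rho_of u x;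
  fp_c : 0 <= c_of u;
  fp_fin : (\int[mu]_(x in `[0%R, 1%R]) (rho_of u x)%:E < +oo)%E }.

Definition pairing u h : \bar R :=
  ((c_of u)%:E * h 0%R + \int[mu]_(x in `[0%R, 1%R]) (h x * (rho_of u x)%:E))%E.

Lemma fp_integrable u : finite_pos u -> mu.-integrable I01 (EFin \o rho_of u).
Proof.
move=> [mu0 r0 c0 fin]; apply/integrableP; split; first exact/measurable_EFinP.
rewrite (_ : (\int[_]_(x in _) _ = \int[mu]_(x in `[0%R, 1%R]) (rho_of u x)%:E)%E)//.
apply: eq_integral => x; rewrite inE/= in_itv/= => x01.
by rewrite ger0_norm ?r0.
Qed.

Section Distribution.
Variable u : umeas R.
Hypothesis fu : finite_pos u.

Let sub01 r : 0 <= r -> (`[r, 1]%classic : set R) `<=` I01.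
Proof. by move=> r0; apply: subset_itvr; rewrite bnd_simp. Qed.

Lemma FdE r : 0 <= r -> (Fd r (rho_of u))%:E = (\int[mu]_(x in `[r, 1%R]) (rho_of u x)%:E)%E.
Proof.
move=> r0; rewrite /Fd /Rintegral fineK//; apply: integrable_fin_num => //.
by apply: integrableS (fp_integrable fu) => //; exact: sub01.
Qed.

Lemma Fd_ge0 r : 0 <= r -> 0 <= Fd r (rho_of u).
Proof.
move=> r0; rewrite -lee_fin FdE//; apply: integral_ge0 => x /(sub01 r0).
by rewrite /= in_itv/= lee_fin => /(fp_rho fu).
Qed.

Lemma Fd_nonincreasing r s : 0 <= r -> r <= s -> Fd s (rho_of u) <= Fd r (rho_of u).
Proof.
move=> r0 rs; have s0 := le_trans r0 rs.
rewrite -lee_fin !FdE//; apply: ge0_subset_integral => //.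
- apply/measurable_EFinP; apply: measurable_funS (fp_meas fu) => //; exact: sub01.
- by move=> x /(sub01 r0); rewrite /= in_itv/= lee_fin => /(fp_rho fu).
- by apply: subset_itvr; rewrite bnd_simp.
Qed.

Lemma Fd1 : Fd 1 (rho_of u) = 0.
Proof. by rewrite /Fd set_itv1 Rintegral_set1. Qed.

Lemma FdB r : 0 <= r <= 1 ->
  Fd r (rho_of u) = Fd 0 (rho_of u) - parameterized_integral mu 0 r (rho_of u).
Proof.
move=> /andP[r0 r1]; rewrite /Fd /parameterized_integral.
rewrite Rintegral_itvB ?bnd_simp//; last exact: fp_integrable.
rewrite Rintegral_itv_obnd_cbnd//.
apply: integrableS (fp_integrable fu) => //.
by apply: subset_itvr; rewrite bnd_simp.
Qed.

(** An absolutely continuous part has no jumps. This makes the cut level attained, and lets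
    comparisons for [r > 0] pass to the limit [r = 0]. *)
Lemma Fd_continuous : {within I01, continuous (fun r => Fd r (rho_of u))}.
Proof.
apply: (subspace_eq_continuous (f := fun r => Fd 0 (rho_of u) - parameterized_integral mu 0 r (rho_of u))).
  by move=> r; rewrite inE/= in_itv/= => r01; exact/esym/FdB.
move=> r; apply: cvgB; first exact: cvg_cst.
by apply: parameterized_integral_continuous => //; exact: fp_integrable.
Qed.

Lemma Fd_near r e : 0 <= r <= 1 -> 0 < e -> exists2 d, 0 < d &
  forall s, 0 <= s <= 1 -> `|r - s| < d -> `|Fd r (rho_of u) - Fd s (rho_of u)| < e.
Proof.
move=> r01 e0; have r01' : I01 r by rewrite /= in_itv.
have /subspace_continuousP/(_ r r01')/cvgrPdist_lt/(_ e e0) := Fd_continuous.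
rewrite near_withinE => /nbhs_ballP[d /= d0 rd]; exists d => // s s01 rs.
by apply: rd => //=; rewrite in_itv.
Qed.

Lemma F_gt0 r : 0 < r -> F r u = Fd r (rho_of u).
Proof. by move=> r0; rewrite /F (lt_geF r0) andbF add0r. Qed.

Lemma F_eq0 : F 0 u = c_of u + Fd 0 (rho_of u).
Proof. by rewrite /F lexx. Qed.

End Distribution.

(** The indicator of [[r, 1]] with its reflections. The map [x |-> cos (pi x)] is even, 2-periodic
    and decreasing on [[0, 1]], so it performs the folding of the line. *)
Definition step r x : \bar R := if cos (pi * x) <= cos (pi * r) then 1%E else 0%E.

Lemma stepE r x : 0 <= r <= 1 -> 0 <= x <= 1 -> step r x = if r <= x then 1%E else 0%E.
Proof.
move=> /andP[r0 r1] /andP[x0 x1]; have p0 := pi_gt0 R.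
have in0pi (z : R) : 0 <= z -> z <= 1 -> pi * z \in `[0, pi].
  move=> z0 z1; rewrite in_itv/=; apply/andP; split; first exact: mulr_ge0 (ltW p0) z0.
  by rewrite -[leRHS]mulr1 ler_pM2l.
by rewrite /step !leNgt ltr_cos ?in0pi// ltr_pM2l.
Qed.

Lemma step_reflected r : reflected (step r).
Proof.
split.
- apply: measurable_fun_ifT => //; apply: measurable_fun_ler => //.
  apply: measurableT_comp; last exact: measurable_funM.
  by apply: continuous_measurable_fun; exact: continuous_cos.
- by move=> x; rewrite /step; case: ifP.
- by move=> x; rewrite /step; case: ifP.
- by move=> x; rewrite /step mulrN cosN.
- by move=> x; rewrite /step mulrDr mulr_natr cosD2pi.
Qed.

Lemma step_nondecreasing01 r : 0 <= r <= 1 -> nondecreasing01 (step r).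
Proof.
move=> r01 x y x0 xy y1; rewrite !stepE//; try by apply/andP; split; lra.
by case: ifP => [rx|_]; [rewrite (le_trans rx xy)|case: ifP].
Qed.

Lemma F_pairing u r : finite_pos u -> 0 <= r <= 1 -> (F r u)%:E = pairing u (step r).
Proof.
move=> fu /[dup] r01 /andP[r0 r1]; rewrite /F /pairing EFinD; congr (_ + _)%E.
  rewrite stepE ?lexx ?ler01// r0/=.
  by case: ifP => _; rewrite ?mule1 ?mule0.
rewrite FdE// integral_mkcond [RHS]integral_mkcond; apply: eq_integral => x _.
rewrite !patchE; case: ifPn => [|xr].
  rewrite inE/= in_itv/= => /andP[rx x1].
  have x0 := le_trans r0 rx.
  by rewrite mem_set/= ?in_itv/= ?x0// stepE ?rx ?mul1e// x0.
case: ifPn => //; rewrite inE/= in_itv/= => x01.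
rewrite stepE// ifF ?mul0e//; apply/negP => rx; move: xr; rewrite notin_setE/= in_itv/= rx.
by case/andP: x01 => _ ->.
Qed.

End States.

(** * The operator G *)

Section Operators.
Context {R : realType}.
Local Notation mu := (@lebesgue_measure R).
Local Notation I01 := (`[0%R, 1%R]%classic : set R).
Implicit Types (u v w : umeas R) (f g h : R -> \bar R) (r s t x y : R).

(** The density is constrained on [[0, 1]] only; its extension by zero allows Tonelli to be used on
    the whole line. *)
Lemma measurable_rho_restrict u : finite_pos u ->
  measurable_fun [set: R] ((fun x => (rho_of u x)%:E) \_ I01).
Proof.
move=> fu; apply/(measurable_restrictT _ _).1 => //.
by apply/measurable_EFinP; exact: fp_meas.
Qed.

Lemma rho_restrict_ge0 u x : finite_pos u ->
  (0 <= ((fun x => (rho_of u x)%:E) \_ I01) x)%E.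
Proof.
by move=> fu; apply: erestrict_ge0 => z; rewrite /= in_itv/= lee_fin => /(fp_rho fu).
Qed.

Section tonelli01.
Variables (K : R * R -> \bar R) (f : R -> \bar R) (u : umeas R).
Hypothesis fu : finite_pos u.
Hypothesis mK : measurable_fun [set: R * R] K.
Hypothesis K0 : forall p, (0 <= K p)%E.
Hypothesis mf : measurable_fun [set: R] f.
Hypothesis f0 : forall x, (0 <= f x)%E.

Let rho := (fun x => (rho_of u x)%:E) \_ I01.
Let mrho : measurable_fun [set: R] rho := measurable_rho_restrict fu.
Let rho0 x : (0 <= rho x)%E := rho_restrict_ge0 x fu.

Let inner x : (\int[mu]_(y in `[0%R, 1%R]) (K (x, y) * (rho_of u y)%:E) =
  \int[mu]_y (K (x, y) * rho y))%E.
Proof.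
rewrite integral_mkcond; apply: eq_integral => y _.
by rewrite /rho !patchE; case: ifP => // _; rewrite mule0.
Qed.

Lemma measurable_tonelli01 : measurable_fun [set: R]
  (fun x => \int[mu]_(y in `[0%R, 1%R]) (K (x, y) * (rho_of u y)%:E))%E.
Proof.
under eq_fun do rewrite inner.
apply: (measurable_fun_fubini_tonelli_F (m2 := mu)
  (fun p : measurableTypeR R * measurableTypeR R => K p * rho p.2)%E).
  by apply: emeasurable_funM => //; apply: (measurableT_comp mrho); exact: measurable_snd.
by move=> p; rewrite mule_ge0.
Qed.

Lemma tonelli01 :
  (\int[mu]_(x in `[0%R, 1%R]) (f x * \int[mu]_(y in `[0%R, 1%R]) (K (x, y) * (rho_of u y)%:E)) =
   \int[mu]_(y in `[0%R, 1%R]) ((\int[mu]_(x in `[0%R, 1%R]) (f x * K (x, y))) * (rho_of u y)%:E))%E.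
Proof.
pose f1 := f \_ I01.
have mf1 : measurable_fun [set: R] f1.
  by apply/(measurable_restrictT _ _).1 => //; exact: measurable_funTS.
have f10 x : (0 <= f1 x)%E by exact: erestrict_ge0.
have mKx x : measurable_fun [set: R] (fun y => K (x, y)).
  exact: (measurableT_comp mK (pair1_measurable x)).
have mKy y : measurable_fun [set: R] (fun x => K (x, y)).
  exact: (measurableT_comp mK (pair2_measurable y)).
transitivity (\int[mu]_x \int[mu]_y (f1 x * K (x, y) * rho y))%E.
  rewrite integral_mkcond; apply: eq_integral => x _.
  rewrite patchE; transitivity (f1 x * \int[mu]_y (K (x, y) * rho y))%E.
    by rewrite /f1 patchE; case: ifP => _; rewrite ?inner ?mul0e.
  rewrite -ge0_integralZl//.
  - by apply: eq_integral => y _; rewrite muleA.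
  - by apply: emeasurable_funM; [exact: mKx|exact: mrho].
  - by move=> y _; rewrite mule_ge0 ?K0 ?rho0.
rewrite (fubini_tonelli (m1 := mu) (m2 := mu)
  (fun p : measurableTypeR R * measurableTypeR R => f1 p.1 * K p * rho p.2)%E).
- rewrite [RHS]integral_mkcond; apply: eq_integral => y _ /=.
  rewrite patchE; transitivity ((\int[mu]_x (f1 x * K (x, y))) * rho y)%E.
    rewrite ge0_integralZr//; first by apply: emeasurable_funM; [exact: mf1|exact: mKy].
    by move=> x _; rewrite mule_ge0 ?f10 ?K0.
  rewrite /rho patchE; case: ifP => _; last by rewrite mule0.
  congr (_ * _)%E; rewrite [RHS]integral_mkcond; apply: eq_integral => x _.
  by rewrite /f1 !patchE; case: ifP => // _; rewrite mul0e.
- apply: emeasurable_funM; first (apply: emeasurable_funM => //; apply: (measurableT_comp mf1); exact: measurable_fst).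
  by apply: (measurableT_comp mrho); exact: measurable_snd.
- by move=> p; rewrite !mule_ge0 ?f10 ?K0 ?rho0.
Qed.

End tonelli01.

Lemma pairing_rho_ge0 u h x : finite_pos u -> (forall x, 0 <= h x)%E -> 0 <= x <= 1 ->
  (0 <= h x * (rho_of u x)%:E)%E.
Proof. by move=> fu h0 x01; rewrite mule_ge0// lee_fin (fp_rho fu). Qed.

Lemma measurable_pairing u h : finite_pos u -> measurable_fun [set: R] h ->
  measurable_fun I01 (fun x => h x * (rho_of u x)%:E)%E.
Proof.
move=> fu mh; apply: emeasurable_funM; first exact: measurable_funTS.
by apply/measurable_EFinP; exact: fp_meas.
Qed.

Section Gconv.
Variables (t : R) (u : umeas R).
Hypothesis t0 : 0 < t.
Hypothesis fu : finite_pos u.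

Let K (p : R * R) : \bar R := image_sum t p.1 p.2.
Let mK : measurable_fun [set: R * R] K := measurable_image_sum t.
Let K0 p : (0 <= K p)%E := image_sum_ge0 t p.1 p.2.

(** [Gconv] is built from a real limit and a real integral, which take default values when the
    quantity is not finite. The convergence of the images and the uniform bound on the kernel rule
    this out. *)
Lemma rho_Gconv x : 0 <= x <= 1 -> (rho_of (Gconv t u) x)%:E =
  ((c_of u)%:E * image_sum t x 0%R +
   \int[mu]_(y in `[0%R, 1%R]) (image_sum t x y * (rho_of u y)%:E))%E.
Proof.
move=> x01; rewrite /Gconv/= EFinD; congr (_ + _)%E.
  by rewrite EFinM Gneum_image_sum// lexx ler01.
have E : (\int[mu]_(y in `[0%R, 1%R]) (Gneum t x y * rho_of u y)%:E =
  \int[mu]_(y in `[0%R, 1%R]) (image_sum t x y * (rho_of u y)%:E))%E.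
  apply: eq_integral => y; rewrite inE/= in_itv/= => y01.
  by rewrite EFinM Gneum_image_sum.
rewrite /Rintegral E fineK// ge0_fin_numE; last first.
  apply: integral_ge0 => y; rewrite /= in_itv/= => y01.
  by rewrite mule_ge0 ?image_sum_ge0// lee_fin (fp_rho fu).
pose b := image_bound t * (1 - expR (- (2 * t)^-1))^-1.
have b0 : 0 <= b.
  rewrite mulr_ge0 ?image_bound_ge0// invr_ge0 subr_ge0 expR_le1 oppr_le0.
  by rewrite invr_ge0 mulr_ge0// ltW.
apply: (@le_lt_trans _ _ (\int[mu]_(y in `[0%R, 1%R]) (b%:E * (rho_of u y)%:E))%E).
  apply: ge0_le_integral => //.
  - move=> y; rewrite /= in_itv/= => y01.
    by rewrite mule_ge0 ?image_sum_ge0// lee_fin (fp_rho fu).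
  - apply: (measurable_pairing fu (h := fun y => image_sum t x y)).
    exact: (measurableT_comp mK (pair1_measurable x)).
  - by apply: measurable_funeM; apply/measurable_EFinP; exact: fp_meas.
  - move=> y; rewrite /= in_itv/= => y01.
    by rewrite lee_wpmul2r ?lee_fin ?(fp_rho fu)// -Gneum_image_sum// lee_fin Gneum_le.
rewrite ge0_integralZl_EFin//.
- by rewrite lte_mul_pinfty// fp_fin.
- by move=> y; rewrite /= in_itv/= lee_fin => /(fp_rho fu).
- by apply/measurable_EFinP; exact: fp_meas.
Qed.

(** Duality: Tonelli moves the kernel onto the test function, where unfolding turns it into a
    Gaussian convolution on the line. The atom contributes the value at [y = 0]. *)
Lemma pairing_Gconv f : reflected f ->
  pairing (Gconv t u) f = pairing u (convol (Gauss t) f).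
Proof.
move=> rf; have [mf f0 f1 fN f2] := rf.
rewrite {1}/pairing mul0e add0e.
have mKy y : measurable_fun [set: R] (fun x => image_sum t x y).
  exact: (measurableT_comp mK (pair2_measurable y)).
have imgE y : (\int[mu]_(x in `[0%R, 1%R]) (f x * image_sum t x y) = convol (Gauss t) f y)%E.
  by apply: integral_image_sum => // x; exact: refl_fin.
transitivity (\int[mu]_(x in `[0%R, 1%R]) ((c_of u)%:E * (f x * image_sum t x 0%R) +
   f x * \int[mu]_(y in `[0%R, 1%R]) (K (x, y) * (rho_of u y)%:E)))%E.
  apply: eq_integral => x; rewrite inE/= in_itv/= => x01.
  rewrite rho_Gconv// ge0_muleDr.
  - by rewrite muleCA.
  - by rewrite mule_ge0 ?image_sum_ge0// lee_fin fp_c.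
  - apply: integral_ge0 => y; rewrite /= in_itv/= => y01.
    by rewrite mule_ge0 ?image_sum_ge0// lee_fin (fp_rho fu).
rewrite ge0_integralD//.
- rewrite ge0_integralZl_EFin//.
  + rewrite imgE; congr (_ + _)%E; rewrite (tonelli01 fu mK K0 mf f0).
    by apply: eq_integral => y _; rewrite imgE.
  + by move=> x _; rewrite mule_ge0// image_sum_ge0.
  + by apply: measurable_funTS; apply: emeasurable_funM => //; exact: mKy.
  + exact: fp_c.
- by move=> x _; rewrite !mule_ge0 ?image_sum_ge0// lee_fin fp_c.
- by apply: measurable_funeM; apply: measurable_funTS; apply: emeasurable_funM => //; exact: mKy.
- move=> x _; rewrite mule_ge0//; apply: integral_ge0 => y; rewrite /= in_itv/= => y01.
  by rewrite mule_ge0// lee_fin (fp_rho fu).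
- apply: measurable_funTS; apply: emeasurable_funM => //.
  exact: measurable_tonelli01.
Qed.

End Gconv.

Lemma reflected_cst1 : reflected (cst 1%E : R -> \bar R).
Proof. by split=> // x; rewrite lexx. Qed.

Lemma pairing1 u : finite_pos u -> pairing u (cst 1%E) = (F 0 u)%:E.
Proof.
move=> fu; rewrite F_pairing// ?lexx ?ler01// /pairing; congr (_ + _)%E.
  by rewrite stepE ?lexx ?ler01.
by apply: eq_integral => x; rewrite inE/= in_itv/= => /[dup] x01 /andP[x0 _]; rewrite stepE ?lexx ?ler01// x0.
Qed.

Lemma finite_pos_Gconv t u : 0 < t -> finite_pos u -> finite_pos (Gconv t u).
Proof.
move=> t0 fu; split => //.
- apply/measurable_EFinP.
  apply: (eq_measurable_fun (fun x => (c_of u)%:E * image_sum t x 0%R +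
    \int[mu]_(y in `[0%R, 1%R]) (image_sum t x y * (rho_of u y)%:E))%E).
    by move=> x; rewrite inE/= in_itv/= => x01; rewrite -rho_Gconv.
  apply: measurable_funTS; apply: emeasurable_funD.
    apply: measurable_funeM; exact: (measurableT_comp (measurable_image_sum t) (pair2_measurable (0 : R))).
  apply: (measurable_tonelli01 (K := fun p => image_sum t p.1 p.2)) => //.
    exact: measurable_image_sum.
  by move=> p; exact: image_sum_ge0.
- move=> x x01; rewrite -lee_fin rho_Gconv// adde_ge0//.
    by rewrite mule_ge0 ?image_sum_ge0// lee_fin fp_c.
  apply: integral_ge0 => y; rewrite /= in_itv/= => y01.
  by rewrite mule_ge0 ?image_sum_ge0// lee_fin (fp_rho fu).
(* The flow fixes the constant 1, so pairing with it shows that the new density has the finite total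
   mass of [u]. *)
- have := pairing_Gconv t0 fu reflected_cst1.
  have -> : convol (Gauss t) (cst 1%E) = cst 1%E :> (R -> \bar R) by apply/funext => y; rewrite convol_cst1.
  rewrite (pairing1 fu) /pairing mul0e add0e => E.
  rewrite (_ : (\int[_]_(x in _) _ = (F 0 u)%:E)%E) ?ltry// -E.
  by apply: eq_integral => x _; rewrite mul1e.
Qed.

Lemma F_Gconv t u r : 0 < t -> finite_pos u -> 0 <= r <= 1 ->
  (F r (Gconv t u))%:E = pairing u (convol (Gauss t) (step r)).
Proof.
move=> t0 fu r01; rewrite F_pairing//; last exact: finite_pos_Gconv.
by rewrite pairing_Gconv//; exact: step_reflected.
Qed.

Lemma F0_Gconv t u : 0 < t -> finite_pos u -> F 0 (Gconv t u) = F 0 u.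
Proof.
move=> t0 fu; apply: EFin_inj.
rewrite -(pairing1 fu) -(pairing1 (finite_pos_Gconv t0 fu)).
rewrite (pairing_Gconv t0 fu reflected_cst1).
by congr (pairing u _); apply/funext => y; rewrite convol_cst1.
Qed.

(** By duality both flows act on the step function, the outer one first, and the semigroup law on
    the line merges them. *)
Lemma Gconv_Gconv s t u r : 0 < s -> 0 < t -> finite_pos u -> 0 <= r <= 1 ->
  F r (Gconv s (Gconv t u)) = F r (Gconv (s + t) u).
Proof.
move=> s0 t0 fu r01; have st0 := addr_gt0 s0 t0.
have [ms s0' _ _ _] := step_reflected r.
apply: EFin_inj.
rewrite (F_Gconv s0 (finite_pos_Gconv t0 fu) r01) (F_Gconv st0 fu r01).
rewrite (pairing_Gconv t0 fu (convol_Gauss_reflected s0 (step_reflected r))).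
by congr (pairing u _); apply/funext => y; exact: heat_semigroup.
Qed.

End Operators.

(** * Monotonicity of G for the mass transport order *)

Section Comparison.
Context {R : realType}.
Local Notation mu := (@lebesgue_measure R).
Local Notation I01 := (`[0%R, 1%R]%classic : set R).
Implicit Types (u v w : umeas R) (f g h : R -> \bar R) (r s t x y : R).

(** At [r = 0] the order compares total masses, atoms included, which says nothing about the
    densities alone; there the inequality is the limit of those at [r > 0]. *)
Lemma ule_Fd u v r : finite_pos u -> finite_pos v -> ule u v -> 0 <= r <= 1 ->
  Fd r (rho_of u) <= Fd r (rho_of v).
Proof.
move=> fu fv uv /andP[]; rewrite le_eqVlt => /predU1P[<- _|r0 r1]; last first.
  by rewrite -!F_gt0// uv// ltW.
rewrite leNgt; apply/negP => vu.
have z01 : 0 <= (0 : R) <= 1 by rewrite lexx ler01.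
have e0 : 0 < Fd 0 (rho_of u) - Fd 0 (rho_of v) by rewrite subr_gt0.
have [d d0 near0] := Fd_near fu z01 e0.
pose s := Num.min (d / 2) 1.
have s0 : 0 < s by rewrite /s lt_min ltr01 divr_gt0.
have s1 : s <= 1 by rewrite /s ge_min lexx orbT.
have sd : s < d by rewrite /s gt_min; apply/orP; left; lra.
have := near0 s; rewrite sub0r normrN gtr0_norm// ltW//= => /(_ s1 sd).
have us : Fd s (rho_of u) <= Fd s (rho_of v).
  by rewrite -!F_gt0// uv// s1 ltW.
have := Fd_nonincreasing fv (lexx 0) (ltW s0).
have := Fd_nonincreasing fu (lexx 0) (ltW s0).
by move=> h1 h2; rewrite ger0_norm ?subr_ge0//; lra.
Qed.

(** * Upper sets, layer-cake decomposition and monotone test functions *)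

Definition ind01 (B : R -> bool) x : \bar R := if B x then 1%E else 0%E.

(** An upper set of [[0, 1]] is an interval starting at its infimum, open or closed there; the
    endpoint is a null set. *)
Lemma integral_upper_set u (B : R -> bool) : finite_pos u ->
  (forall x y, 0 <= x -> x <= y -> y <= 1 -> B x -> B y) -> (exists2 x, 0 <= x <= 1 & B x) ->
  (\int[mu]_(x in `[0%R, 1%R]) (ind01 B x * (rho_of u x)%:E))%E =
  (Fd (inf [set x | 0 <= x <= 1 /\ B x]) (rho_of u))%:E.
Proof.
move=> fu Bup [x0 x01 Bx0]; set E := [set x : R | 0 <= x <= 1 /\ B x]; set a := inf E.
have hE : has_inf E by split; [exists x0|exists 0 => y [/andP[]]].
have a0 : 0 <= a by apply: lb_le_inf; [exists x0|move=> y [/andP[]]].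
have aE x : E x -> a <= x by move=> Ex; apply: ge_inf Ex; exists 0 => y [/andP[]].
have Ex0 : E x0 by split.
have a1 : a <= 1 by case/andP: x01 => _; exact: le_trans (aE _ Ex0).
have Ba x : a < x -> x <= 1 -> B x.
  move=> ax x1; have [y [/andP[y0 y1] By] yx] := inf_lt (proj1 hE) ax.
  exact: Bup y0 (ltW yx) x1 By.
have nBa x : 0 <= x <= 1 -> x < a -> B x = false.
  move=> x01' xa; apply/negP => Bx.
  by have : a <= x; [apply: aE; split|rewrite leNgt xa].
rewrite FdE//.
(* The boolean [b] records whether the infimum belongs to the set, hence whether the interval is
   closed on the left. *)
have E1 (b : bool) : B a = b ->
    (\int[mu]_(x in `[0%R, 1%R]) (ind01 B x * (rho_of u x)%:E) =
     \int[mu]_(x in [set` Interval (BSide b a) (BRight 1%R)]) (rho_of u x)%:E)%E.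
  move=> Bab; rewrite integral_mkcond [RHS]integral_mkcond; apply: eq_integral => x _.
  rewrite !patchE; case: ifPn => [|xI].
    rewrite inE/= in_itv/= => /[dup] x01' /andP[xx0 x1]; rewrite /ind01.
    have [xa|ax|xa] := ltgtP x a.
    - rewrite nBa// mul0e ifF//; apply/negP; rewrite inE/= in_itv/=.
      by case: (b) => /=; [rewrite leNgt xa|rewrite ltNge (ltW xa)].
    - rewrite Ba// mul1e ifT// inE/= in_itv/= x1 andbT.
      by case: (b) => //=; exact: ltW.
    - rewrite xa Bab; case: (b) => /=.
        by rewrite mul1e ifT// inE/= in_itv/= lexx.
      by rewrite mul0e ifF//; apply/negP; rewrite inE/= in_itv/= ltxx.
  rewrite ifF//; apply/negP; rewrite inE/= in_itv/= => /andP[ax x1].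
  move/negP: xI; apply; rewrite inE/= in_itv/= x1 andbT (le_trans a0)//.
  by case: (b) ax => //= /ltW.
have [Bab|Bab] := boolP (B a); first by rewrite (E1 true).
rewrite (E1 false); last exact/negbTE.
rewrite integral_itv_obnd_cbnd//.
apply/measurable_EFinP; apply: measurable_funS (fp_meas fu) => //.
by apply: subset_itvr; rewrite bnd_simp.
Qed.

(** If [B] contains 0 it contains [[0, 1]], and total masses are compared. Otherwise the atoms are
    not counted and only densities matter, even when the infimum of [B] is 0. *)
Lemma le_pairing_upper_set u v (B : R -> bool) : finite_pos u -> finite_pos v ->
  ule u v -> (forall x y, 0 <= x -> x <= y -> y <= 1 -> B x -> B y) ->
  (pairing u (ind01 B) <= pairing v (ind01 B))%E.
Proof.
move=> fu fv uv Bup.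
have [B0|B0] := boolP (B 0).
  have e w : finite_pos w -> pairing w (ind01 B) = (F 0 w)%:E.
    move=> fw; rewrite -(pairing1 fw) /pairing /ind01 B0; congr (_ + _)%E.
    apply: eq_integral => x; rewrite inE/= in_itv/= => /andP[x0 x1].
    by rewrite (Bup 0).
  by rewrite !e// lee_fin uv// lexx ler01.
rewrite /pairing {1 3}/ind01 (negbTE B0) !mule0 !add0e.
have [[x x01 Bx]|nB] := pselect (exists2 x, 0 <= x <= 1 & B x).
  rewrite !integral_upper_set//; [|by exists x|by exists x].
  rewrite lee_fin; apply: ule_Fd => //; apply/andP; split.
    by apply: lb_le_inf; [exists x|move=> y [/andP[]]].
  apply: (@le_trans _ _ x); last by case/andP: x01.
  by apply: ge_inf; [exists 0 => y [/andP[]]|].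
have e w : (\int[mu]_(x in `[0%R, 1%R]) (ind01 B x * (rho_of w x)%:E) = 0)%E.
  apply: integral0_eq => x; rewrite /= in_itv/= => x01.
  rewrite /ind01 ifF ?mul0e//; apply/negP => Bx; apply: nB; by exists x.
by rewrite !e.
Qed.

(** The layer-cake integrand: integrated over levels [p.1] in [[0, 1]], the range of a reflected
    [h], it returns [h p.2]. *)
Definition superlevel h (p : R * R) : \bar R := ind01 (fun y => p.1 < fine (h y)) p.2.

Lemma measurable_superlevel h : measurable_fun [set: R] h ->
  measurable_fun [set: R * R] (superlevel h).
Proof.
move=> mh; apply: measurable_fun_ifT => //.
apply: measurable_fun_ltr; first exact: measurable_fst.
apply: (measurableT_comp (f := fun y => fine (h y))); last exact: measurable_snd.
exact: measurableT_comp.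
Qed.

Lemma superlevel_ge0 h p : (0 <= superlevel h p)%E.
Proof. by rewrite /superlevel /ind01; case: ifP. Qed.

Lemma integral_superlevel h y : reflected h ->
  (\int[mu]_(s in `[0%R, 1%R]) superlevel h (s, y) = h y)%E.
Proof.
move=> rh; have h0 : 0 <= fine (h y) by rewrite fine_ge0// refl_ge0.
have h1 : fine (h y) <= 1 by rewrite -lee_fin fineK ?refl_fin// refl_le1.
transitivity (\int[mu]_(s in `[0%R, 1%R]) (\1_(`[0%R, fine (h y)[%classic : set R) s)%:E)%E.
  apply: eq_integral => s; rewrite inE/= in_itv/= => /andP[s0 s1].
  rewrite /superlevel /ind01 indicE/= mem_setE in_itv/= s0/=.
  by case: ifP.
rewrite integral_indic// setIidl; last first.
  by move=> s /=; rewrite !in_itv/= => /andP[-> /ltW sh]; exact: le_trans sh h1.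
apply: etrans; first exact: (lebesgue_measure_itv `[0, fine (h y)[).
rewrite /= lte_fin; case: ifPn => [_|].
  by rewrite oppr0 adde0 fineK// refl_fin.
rewrite -leNgt => hle; have hE : fine (h y) = 0 by lra.
by rewrite -[RHS]fineK ?refl_fin// hE.
Qed.

Lemma pairing_superlevel u h : finite_pos u -> reflected h ->
  pairing u h = (\int[mu]_(s in `[0%R, 1%R]) pairing u (fun y => superlevel h (s, y)))%E.
Proof.
move=> fu rh; have mh := refl_meas rh.
have mS := measurable_superlevel mh; have S0 := superlevel_ge0 h.
have mSy y : measurable_fun I01 (fun s => superlevel h (s, y)).
  by apply: measurable_funTS; exact: (measurableT_comp mS (pair2_measurable y)).
have int0 s : (0 <= \int[mu]_(y in `[0%R, 1%R]) (superlevel h (s, y) * (rho_of u y)%:E))%E.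
  apply: integral_ge0 => y; rewrite /= in_itv/= => y01.
  by rewrite mule_ge0// lee_fin (fp_rho fu).
rewrite /pairing ge0_integralD//.
- rewrite ge0_integralZl_EFin//; last exact: fp_c.
  rewrite (integral_superlevel 0 rh); congr (_ + _)%E.
  have T := tonelli01 (f := cst 1%E) fu mS S0 (measurable_cst _) (fun=> lee01).
  apply: etrans (etrans (esym T) _); apply: eq_integral => x _; rewrite /cst ?mul1e//.
  by congr (_ * _)%E; rewrite -[LHS](integral_superlevel x rh); apply: eq_integral => s _; rewrite mul1e.
- exact: mSy.
- by move=> s _; rewrite mule_ge0// lee_fin fp_c.
- by apply: measurable_funeM; exact: mSy.
- apply: measurable_funTS; exact: (measurable_tonelli01 fu mS S0).
Qed.

(** Each superlevel set of a nondecreasing [h] is an upper set, so the inequality holds level by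
    level and is integrated over the levels. *)
Lemma le_pairing_ule u v h : finite_pos u -> finite_pos v -> ule u v ->
  reflected h -> nondecreasing01 h -> (pairing u h <= pairing v h)%E.
Proof.
move=> fu fv uv rh nh; rewrite (pairing_superlevel fu rh) (pairing_superlevel fv rh).
have mS := measurable_superlevel (refl_meas rh); have S0 := superlevel_ge0 h.
have p0 w s : finite_pos w -> (0 <= pairing w (fun y => superlevel h (s, y)))%E.
  move=> fw; rewrite adde_ge0 ?mule_ge0 ?lee_fin ?fp_c//.
  apply: integral_ge0 => y; rewrite /= in_itv/= => y01.
  by rewrite mule_ge0// lee_fin (fp_rho fw).
have mp w : finite_pos w -> measurable_fun I01 (fun s => pairing w (fun y => superlevel h (s, y))).
  move=> fw; apply: measurable_funTS; apply: emeasurable_funD.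
    by apply: measurable_funeM; exact: (measurableT_comp mS (pair2_measurable (0 : R))).
  exact: (measurable_tonelli01 fw mS S0).
apply: ge0_le_integral => //.
- by move=> s _; exact: p0.
- exact: mp.
- exact: mp.
move=> s _; apply: (le_pairing_upper_set (B := fun y => s < fine (h y))) => // x y x0 xy y1 /lt_le_trans; apply.
by apply: fine_le; rewrite ?refl_fin//; exact: nh.
Qed.

Lemma Gconv_ule t u v : 0 < t -> finite_pos u -> finite_pos v -> ule u v ->
  ule (Gconv t u) (Gconv t v).
Proof.
move=> t0 fu fv uv r r01; rewrite -lee_fin (F_Gconv t0 fu r01) (F_Gconv t0 fv r01).
have rs := step_reflected r.
exact: (le_pairing_ule fu fv uv (convol_Gauss_reflected t0 rs)
  (heat_nondecreasing01 t0 rs (step_nondecreasing01 r01))).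
Qed.

End Comparison.

(** * The cut-and-paste operator *)

Section CutAndPaste.
Context {R : realType}.
Local Notation mu := (@lebesgue_measure R).
Local Notation I01 := (`[0%R, 1%R]%classic : set R).
Implicit Types (u v w : umeas R) (f g h : R -> \bar R) (r s t x y : R).

Section Kcut.
Variables (j d : R) (u : umeas R).
Hypothesis jd0 : 0 < j * d.
Hypothesis fu : finite_pos u.
Hypothesis jdu : j * d < Fd 0 (rho_of u).

(** The point 0 is not in the level set, since the density alone already exceeds [j d]; elsewhere
    [F] is the continuous [Fd]. The intermediate value theorem makes the set nonempty, and
    continuity puts its infimum on the level. *)
Lemma RdeltaP : 0 < Rdelta j d u <= 1 /\ Fd (Rdelta j d u) (rho_of u) = j * d.
Proof.
set S := [set r : R | 0 <= r <= 1 /\ F r u = j * d].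
have SE r : S r -> 0 < r /\ Fd r (rho_of u) = j * d.
  case=> /andP[]; rewrite le_eqVlt => /predU1P[<- _|r0 r1 E].
    by rewrite F_eq0 => E; move: jdu; rewrite -E gtrDr ltNge (fp_c fu).
  by split=> //; rewrite -F_gt0.
have S0 : S !=set0.
  have [|r r01 E] := @IVT _ _ 0 1 (j * d) ler01 (Fd_continuous fu).
    by rewrite Fd1 ge_min le_max (ltW jdu) (ltW jd0) orbT.
  exists r; split; first by move: r01; rewrite in_itv.
  rewrite F_gt0//; move: r01; rewrite in_itv/= => /andP[r0 _].
  rewrite lt_neqAle r0 andbT; apply/negP => /eqP r0E.
  by move: E; rewrite -r0E => E; move: jdu; rewrite E ltxx.
have hS : has_inf S by split=> //; exists 0 => r [/andP[]].
have R0 : 0 <= Rdelta j d u by apply: lb_le_inf => // r [/andP[]].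
have R1 : Rdelta j d u <= 1.
  have [r Sr] := S0; apply: (@le_trans _ _ r); last by case: Sr => /andP[].
  by apply: ge_inf Sr; case: hS.
have FR : Fd (Rdelta j d u) (rho_of u) = j * d.
  apply/eqP; rewrite -subr_eq0 -normr_le0; apply/ler_addgt0Pr => e e0; rewrite add0r.
  have R01 : 0 <= Rdelta j d u <= 1 by rewrite R0.
  have [b b0 nearR] := Fd_near fu R01 e0.
  have [r Sr rb] := inf_adherent b0 hS.
  have [r0 <-] := SE r Sr; apply/ltW/nearR; first by case: Sr.
  have Rr : Rdelta j d u <= r by apply: ge_inf Sr; case: hS.
  by rewrite ler0_norm ?subr_le0// opprB ltrBlDl.
split=> //; rewrite R1 andbT lt_neqAle R0 andbT; apply/negP => /eqP E.
by move: jdu; rewrite -FR -E ltxx.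
Qed.

Lemma finite_pos_Kcut : finite_pos (Kcut j d u).
Proof.
have mK : measurable_fun I01 (rho_of (Kcut j d u)).
  rewrite (_ : rho_of _ = rho_of u \_ (`[0%R, Rdelta j d u]%classic : set R)).
    by apply/measurable_restrict => //; apply: measurable_funS (fp_meas fu) => //; exact: subIsetl.
  by apply/funext => x; rewrite patchE mem_setE in_itv.
split.
- exact: mK.
- by move=> x x01 /=; case: ifP => // _; exact: fp_rho.
- by rewrite addr_ge0 ?fp_c// ltW.
apply: le_lt_trans (fp_fin fu); apply: ge0_le_integral => //.
- move=> x; rewrite /= in_itv/= => x01.
  by rewrite lee_fin; case: ifP => // _; exact: fp_rho.
- by apply/measurable_EFinP; exact: mK.
- by apply/measurable_EFinP; exact: fp_meas.
- move=> x; rewrite /= in_itv/= => x01.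
  by rewrite lee_fin; case: ifP => // _; exact: fp_rho.
Qed.

Lemma Fd_Kcut r : 0 <= r <= 1 -> Fd r (rho_of (Kcut j d u)) =
  if r <= Rdelta j d u then Fd r (rho_of u) - j * d else 0.
Proof.
move=> /andP[r0 r1]; have [/andP[R0 R1] FR] := RdeltaP.
case: ifPn => [rR|]; last first.
  rewrite -ltNge => Rr; rewrite /Fd /Rintegral integral0_eq// => x.
  rewrite /= in_itv/= => /andP[rx _]; rewrite [x <= _]leNgt (lt_le_trans Rr rx) andbF//.
have intr : mu.-integrable (`[r, 1]%classic : set R) (EFin \o rho_of u).
  by apply: integrableS (fp_integrable fu) => //; apply: subset_itvr; rewrite bnd_simp.
have E : \int[mu]_(x in `[r, Rdelta j d u]) rho_of u x = Fd r (rho_of u) - j * d.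
  rewrite -FR /Fd -[X in _ - X]Rintegral_itv_obnd_cbnd; last first.
    by apply: integrableS intr => //; apply: subset_itvr; rewrite bnd_simp.
  rewrite -(Rintegral_itvB intr (x := Rdelta j d u)) ?bnd_simp//; first by ring.
rewrite -E /Fd /Rintegral; congr fine; rewrite integral_mkcond [RHS]integral_mkcond.
apply: eq_integral => x _; rewrite !patchE.
case: ifPn => [|xr].
  rewrite inE/= in_itv/= => /andP[rx x1]; rewrite (le_trans r0 rx)/=.
  case: ifPn => xR; first by rewrite ifT// inE/= in_itv/= rx.
  by rewrite ifF//; apply/negP; rewrite inE/= in_itv/= rx (negbTE xR).
rewrite ifF//; apply/negP; rewrite inE/= in_itv/= => /andP[rx xR].
by move/negP: xr; apply; rewrite inE/= in_itv/= rx (le_trans xR R1).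
Qed.

(** The cut removes exactly the rightmost mass [j d]. This reduces comparisons of cuts to arithmetic
    of maxima; 0 is excluded because the pasted atom counts there. *)
Lemma F_Kcut r : 0 < r <= 1 -> F r (Kcut j d u) = Num.max (F r u - j * d) 0.
Proof.
move=> /andP[r0 r1]; have [/andP[R0 R1] FR] := RdeltaP.
rewrite !F_gt0// Fd_Kcut ?r1 ?andbT ?(ltW r0)//.
case: ifPn => [rR|]; first by rewrite max_l// subr_ge0 -FR; apply: Fd_nonincreasing => //; exact: ltW.
rewrite -ltNge => Rr; rewrite max_r// subr_le0 -FR; apply: Fd_nonincreasing => //; exact: ltW.
Qed.

Lemma Fd0_Kcut : Fd 0 (rho_of (Kcut j d u)) = Fd 0 (rho_of u) - j * d.
Proof.
have [/andP[R0 R1] FR] := RdeltaP.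
by rewrite Fd_Kcut ?lexx ?ler01// ltW.
Qed.

Lemma F0_Kcut : F 0 (Kcut j d u) = F 0 u.
Proof. by rewrite !F_eq0 Fd0_Kcut/=; rewrite /c_of/=; ring. Qed.

(* Only mass j d is moved, and h takes values in [0, 1]. *)
Lemma pairing_Kcut h : reflected h ->
  (pairing u h <= pairing (Kcut j d u) h + (j * d)%:E)%E.
Proof.
move=> rh; have fK := finite_pos_Kcut; have mh := refl_meas rh.
have hf x := refl_fin x rh.
have int_fin w : finite_pos w -> (\int[mu]_(x in `[0%R, 1%R]) (h x * (rho_of w x)%:E))%E \is a fin_num.
  move=> fw; rewrite ge0_fin_numE; last first.
    apply: integral_ge0 => x; rewrite /= in_itv/= => x01.
    by apply: pairing_rho_ge0 => // z; exact: refl_ge0.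
  apply: le_lt_trans (fp_fin fw); apply: ge0_le_integral => //.
  - move=> x; rewrite /= in_itv/= => x01.
    by apply: pairing_rho_ge0 => // z; exact: refl_ge0.
  - exact: measurable_pairing.
  - by apply/measurable_EFinP; exact: fp_meas.
  - move=> x; rewrite /= in_itv/= => x01; rewrite -[leRHS]mul1e lee_wpmul2r ?refl_le1//.
    by rewrite lee_fin (fp_rho fw).
(* On the removed part [h <= 1], so the loss in the pairing is at most the loss of mass. The
   additive form avoids subtraction of extended reals. *)
have key : (\int[mu]_(x in `[0%R, 1%R]) (h x * (rho_of u x)%:E) +
    (Fd 0 (rho_of (Kcut j d u)))%:E <=
    \int[mu]_(x in `[0%R, 1%R]) (h x * (rho_of (Kcut j d u) x)%:E) +
    (Fd 0 (rho_of u))%:E)%E.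
  rewrite (FdE fK (lexx 0)) (FdE fu (lexx 0)).
  have hr0 w x : finite_pos w -> I01 x -> (0 <= h x * (rho_of w x)%:E)%E.
    move=> fw; rewrite /= in_itv/= => x01.
    by apply: pairing_rho_ge0 => // z; exact: refl_ge0.
  have r0 w x : finite_pos w -> I01 x -> (0 <= (rho_of w x)%:E)%E.
    by move=> fw; rewrite /= in_itv/= lee_fin => /(fp_rho fw).
  have mr w : finite_pos w -> measurable_fun I01 (fun x => (rho_of w x)%:E).
    by move=> fw; apply/measurable_EFinP; exact: fp_meas.
  have mhr w : finite_pos w -> measurable_fun I01 (fun x => h x * (rho_of w x)%:E)%E.
    by move=> fw; exact: measurable_pairing.
  rewrite -(ge0_integralD mu _ (fun x => hr0 u x fu) (mhr u fu) (fun x => r0 _ x fK) (mr _ fK))//.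
  rewrite -(ge0_integralD mu _ (fun x => hr0 _ x fK) (mhr _ fK) (fun x => r0 _ x fu) (mr _ fu))//.
  apply: ge0_le_integral => //.
  - by move=> x Ix; rewrite adde_ge0 ?hr0 ?r0.
  - by apply: emeasurable_funD; [exact: mhr|exact: mr].
  - by apply: emeasurable_funD; [exact: mhr|exact: mr].
  move=> x; rewrite /= in_itv/= => /[dup] x01 /andP[x0 _].
  have rx := fp_rho fu x01; rewrite x0/=; case: ifP => _ //.
  rewrite mule0 add0e adde0 -[leRHS]mul1e lee_wpmul2r ?refl_le1//.
rewrite Fd0_Kcut in key.
rewrite /pairing -(fineK (int_fin u fu)) -(fineK (int_fin _ fK)) -(fineK (hf 0)).
rewrite -(fineK (int_fin u fu)) -(fineK (int_fin _ fK)) -!EFinD lee_fin in key.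
rewrite -!EFinM -!EFinD lee_fin /=.
have h0 : 0 <= fine (h 0) by rewrite fine_ge0// refl_ge0.
(* The contribution of the pasted atom is nonnegative and is dropped. *)
have : 0 <= j * d * fine (h 0) by rewrite mulr_ge0// ltW.
move: key; move: (fine (integral _ _ _)) => A; move: (fine (integral _ _ _)) => B.
rewrite /c_of/= mulrDl; move: (j * d * _) => C; lra.
Qed.

End Kcut.

Lemma Kcut_ule j d u v : 0 < j * d -> finite_pos u -> finite_pos v ->
  j * d < Fd 0 (rho_of u) -> j * d < Fd 0 (rho_of v) -> ule u v ->
  ule (Kcut j d u) (Kcut j d v).
Proof.
move=> jd0 fu fv ju jv uv r /andP[]; rewrite le_eqVlt => /predU1P[<- _|r0 r1].
  by rewrite !F0_Kcut// uv// lexx ler01.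
have r01 : 0 < r <= 1 by rewrite r0.
rewrite !F_Kcut//; have : F r u <= F r v by rewrite uv// ltW.
by case: (leP (F r u - j * d) 0); case: (leP (F r v - j * d) 0); lra.
Qed.

(** The test function is the evolved step, which is bounded by 1. The cut [d] and the time [t] are
    independent: the refinement exchanges operators with different parameters. *)
Lemma Kcut_Gconv_ule j d t u : 0 < j * d -> 0 < t -> finite_pos u ->
  j * d < Fd 0 (rho_of u) ->
  ule (Kcut j d (Gconv t u)) (Gconv t (Kcut j d u)).
Proof.
move=> jd0 t0 fu ju.
have fK := finite_pos_Kcut jd0 fu.
have fG := finite_pos_Gconv t0 fu.
have jG : j * d < Fd 0 (rho_of (Gconv t u)).
  have := F0_Gconv t0 fu; rewrite !F_eq0 add0r => ->.
  by have := fp_c fu; lra.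
move=> r /andP[]; rewrite le_eqVlt => /predU1P[<- _|r0 r1].
  by rewrite F0_Kcut// (F0_Gconv t0 fu) (F0_Gconv t0 fK) F0_Kcut.
have r01 : 0 < r <= 1 by rewrite r0.
have r01' : 0 <= r <= 1 by rewrite ltW.
rewrite F_Kcut// ge_max; apply/andP; split; last first.
  by rewrite (F_gt0 _ r0); exact: (Fd_ge0 (finite_pos_Gconv t0 fK) (ltW r0)).
rewrite lerBlDr -lee_fin (EFinD (F r (Gconv t (Kcut j d u)))) (F_Gconv t0 fu r01') (F_Gconv t0 fK r01').
apply: (pairing_Kcut jd0 fu ju).
by apply: convol_Gauss_reflected => //; exact: step_reflected.
Qed.

End CutAndPaste.

(** * Comparison of the barriers *)

(** A cut of [a + b] is a cut of [a] followed by one of [b]: a bound known after the first cut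
    passes through the second. *)
Lemma max_subD (R : realDomainType) (x y a b : R) :
  Num.max (x - a) 0 <= y -> Num.max (x - (b + a)) 0 <= Num.max (y - b) 0.
Proof.
rewrite !ge_max => /andP[xy y0]; rewrite !le_max lexx orbT andbT.
by rewrite opprD addrA [x - b - a]addrAC lerD2r xy.
Qed.

Lemma max_sub_max (R : realDomainType) (x a b : R) : 0 <= b ->
  Num.max (Num.max (x - a) 0 - b) 0 <= Num.max (x - (b + a)) 0.
Proof.
move=> b0; rewrite ge_max !le_max lexx orbT andbT.
have [_|xa] := leP (x - a) 0; first by rewrite sub0r oppr_le0 b0 orbT.
by rewrite opprD addrA addrAC lexx.
Qed.

Section Refinement.
Context {R : realType}.
Variables (j m : R).
Hypothesis j0 : 0 < j.
Implicit Types (u v w : umeas R) (r s t d e : R) (n : nat).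

Lemma ule_refl u : ule u u.
Proof. by move=> r _. Qed.

Lemma ule_trans v u w : ule u v -> ule v w -> ule u w.
Proof. by move=> uv vw r r01; exact: le_trans (uv r r01) (vw r r01). Qed.

Definition state u : Prop := finite_pos u /\ F 0 u = m.
(** All the mass lies in the density, so any cut with [j d < m] is admissible; together with [state]
    this makes the atom vanish. [Gconv] turns every state into a density. *)
Definition density u : Prop := finite_pos u /\ Fd 0 (rho_of u) = m.

Lemma Gconv_state t u : 0 < t -> state u -> state (Gconv t u).
Proof.
by move=> t0 [fu Fu]; split; [exact: finite_pos_Gconv|rewrite F0_Gconv].
Qed.

Lemma Gconv_density t u : 0 < t -> state u -> density (Gconv t u).
Proof.
move=> t0 [fu Fu]; split; first exact: finite_pos_Gconv.
by rewrite -Fu -(F0_Gconv t0 fu) F_eq0 add0r.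
Qed.

Lemma Kcut_state d u : 0 < d -> j * d < Fd 0 (rho_of u) -> state u -> state (Kcut j d u).
Proof.
move=> d0 ju [fu Fu]; have jd0 := mulr_gt0 j0 d0.
by split; [exact: finite_pos_Kcut|rewrite F0_Kcut].
Qed.

#[local] Opaque Gconv Kcut F Fd.

Definition KG d u := Kcut j d (Gconv d u).
Definition GK d u := Gconv d (Kcut j d u).

Section TimeStep.
Variable d : R.
Hypotheses (d0 : 0 < d) (jdm : j * d < m).

Lemma KG_state u : state u -> state (KG d u).
Proof.
move=> su; apply: Kcut_state => //; last exact: Gconv_state.
by have [_ ->] := Gconv_density d0 su.
Qed.

Lemma KG_ule u v : state u -> state v -> ule u v -> ule (KG d u) (KG d v).
Proof.
move=> su sv uv; have jd0 := mulr_gt0 j0 d0.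
have [fGu Gu] := Gconv_density d0 su; have [fGv Gv] := Gconv_density d0 sv.
have ju : j * d < Fd 0 (rho_of (Gconv d u)) by rewrite Gu.
have jv : j * d < Fd 0 (rho_of (Gconv d v)) by rewrite Gv.
exact: (Kcut_ule jd0 fGu fGv ju jv (Gconv_ule d0 (proj1 su) (proj1 sv) uv)).
Qed.

Lemma GK_state u : state u -> density u -> state (GK d u) /\ density (GK d u).
Proof.
move=> su [_ du].
have sK : state (Kcut j d u) by apply: Kcut_state; rewrite ?du.
by split; [exact: Gconv_state|exact: Gconv_density].
Qed.

Lemma GK_ule u v : state u -> density u -> state v -> density v -> ule u v ->
  ule (GK d u) (GK d v).
Proof.
move=> [fu su] [_ du] [fv sv] [_ dv] uv; have jd0 := mulr_gt0 j0 d0.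
have ju : j * d < Fd 0 (rho_of u) by rewrite du.
have jv : j * d < Fd 0 (rho_of v) by rewrite dv.
exact: (Gconv_ule d0 (finite_pos_Kcut jd0 fu) (finite_pos_Kcut jd0 fv)
  (Kcut_ule jd0 fu fv ju jv uv)).
Qed.

Lemma iter_KG_state n u : state u -> state (iter n (KG d) u).
Proof. by move=> su; elim: n => [//|n IH]; rewrite iterS; exact: KG_state. Qed.

Lemma iter_GK_state n u : state u -> density u ->
  state (iter n (GK d) u) /\ density (iter n (GK d) u).
Proof.
by move=> su du; elim: n => [//|n [IH1 IH2]]; rewrite iterS; exact: GK_state.
Qed.

Lemma iter_KG_GK n u : state u -> density u ->
  ule (iter n (KG d) u) (iter n (GK d) u).
Proof.
move=> su du; have jd0 := mulr_gt0 j0 d0.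
elim: n => [|n IH]; first exact: ule_refl.
have [sG [fG dG]] := iter_GK_state n su du.
rewrite !iterS; apply: (@ule_trans (KG d (iter n (GK d) u))).
  exact: (KG_ule (iter_KG_state n su) sG IH).
by apply: (Kcut_Gconv_ule jd0 d0 fG); rewrite dG.
Qed.

End TimeStep.

Lemma natSS_mul n e : n.+2%:R * e = e + n.+1%:R * e.
Proof. by rewrite -[n.+2]addn1 natrD mulrDl mul1r addrC. Qed.

(* In K_(e+a) G_(e+a) = K_e K_a G_e G_a the inner K_a G_e is replaced by G_e K_a. *)
Lemma KG_refine e n u : 0 < e -> j * (n.+1%:R * e) < m -> state u ->
  ule (KG (n.+1%:R * e) u) (iter n.+1 (KG e) u).
Proof.
move=> e0; elim: n => [|n IH] jm su; first by rewrite mul1r; exact: ule_refl.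
set a := n.+1%:R * e in IH *; rewrite natSS_mul -/a in jm *.
have a0 : 0 < a by rewrite mulr_gt0.
have ea0 : 0 < e + a by rewrite addr_gt0.
have jea : j * (e + a) = j * e + j * a by rewrite mulrDr.
have je0 := mulr_gt0 j0 e0; have ja0 := mulr_gt0 j0 a0; have jea0 := mulr_gt0 j0 ea0.
have jem : j * e < m by lra.
have jam : j * a < m by lra.
have [fu _] := su.
have sK := KG_state a0 jam su.
have [fG dG] := Gconv_density a0 su.
have [fGK dGK] := Gconv_density e0 sK.
have [fGG dGG] := Gconv_density ea0 su.
have [fG2 dG2] := Gconv_density e0 (Gconv_state a0 su).
rewrite iterS; apply: (@ule_trans (KG e (KG a u))); last first.
  exact: (KG_ule e0 jem sK (iter_KG_state e0 jem n.+1 su) (IH jam su)).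
(* At [r = 0] both sides have mass [m]. For [r > 0] the comparison is made through [F], where the
   two flows merge and the large cut splits in two. *)
move=> r /andP[]; rewrite le_eqVlt => /predU1P[<- _|r0 r1].
  have [_ ->] := KG_state ea0 jm su.
  by have [_ ->] := KG_state e0 jem sK.
have r01 : 0 < r <= 1 by rewrite r0.
have r01' : 0 <= r <= 1 by rewrite ltW.
have jG : j * a < Fd 0 (rho_of (Gconv a u)) by rewrite dG.
have := Kcut_Gconv_ule ja0 e0 fG jG r01'.
have jG2 : j * a < Fd 0 (rho_of (Gconv e (Gconv a u))) by rewrite dG2.
have jGG : j * (e + a) < Fd 0 (rho_of (Gconv (e + a) u)) by rewrite dGG.
have jGK : j * e < Fd 0 (rho_of (Gconv e (KG a u))) by rewrite dGK.
rewrite (F_Kcut ja0 fG2 jG2 r01) (Gconv_Gconv e0 a0 fu r01').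
rewrite (F_Kcut jea0 fGG jGG r01) (F_Kcut je0 fGK jGK r01).
rewrite jea; exact: max_subD.
Qed.

(** The chain is [G_e K_e G_a K_a <= G_e G_a K_e K_a = G_(e+a) K_e K_a <= G_(e+a) K_(e+a)], with the
    exchange now applied to [K_e G_a]. *)
Lemma GK_refine e n u : 0 < e -> j * (n.+1%:R * e) < m -> state u -> density u ->
  ule (iter n.+1 (GK e) u) (GK (n.+1%:R * e) u).
Proof.
move=> e0; elim: n => [|n IH] jm su du; first by rewrite mul1r; exact: ule_refl.
set a := n.+1%:R * e in IH *; rewrite natSS_mul -/a in jm *.
have a0 : 0 < a by rewrite mulr_gt0.
have ea0 : 0 < e + a by rewrite addr_gt0.
have jea : j * (e + a) = j * e + j * a by rewrite mulrDr.
have je0 := mulr_gt0 j0 e0; have ja0 := mulr_gt0 j0 a0; have jea0 := mulr_gt0 j0 ea0.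
have jem : j * e < m by lra.
have jam : j * a < m by lra.
have [fu Fu] := su; have [_ Fdu] := du.
have ja : j * a < Fd 0 (rho_of u) by rewrite Fdu.
have jea' : j * (e + a) < Fd 0 (rho_of u) by rewrite Fdu.
have [sGa dGa] := GK_state a0 jam su du.
have [sI dI] := iter_GK_state e0 jem n.+1 su du.
have fKa := finite_pos_Kcut ja0 fu.
have jKa : j * e < Fd 0 (rho_of (Kcut j a u)) by rewrite (Fd0_Kcut ja0 fu ja) Fdu; lra.
have fKK := finite_pos_Kcut je0 fKa.
have fKea := finite_pos_Kcut jea0 fu.
rewrite iterS; apply: (@ule_trans (GK e (GK a u))).
  exact: (GK_ule e0 jem sI dI sGa dGa (IH jam su du)).
have [fGa dGa'] := dGa.
have jGa : j * e < Fd 0 (rho_of (GK a u)) by rewrite dGa'.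
apply: (@ule_trans (Gconv e (Gconv a (Kcut j e (Kcut j a u))))).
  apply: (Gconv_ule e0 (finite_pos_Kcut je0 fGa) (finite_pos_Gconv a0 fKK)).
  exact: (Kcut_Gconv_ule je0 a0 fKa jKa).
apply: (@ule_trans (Gconv (e + a) (Kcut j e (Kcut j a u)))).
  by move=> r r01; rewrite (Gconv_Gconv e0 a0 fKK r01).
apply: (Gconv_ule ea0 fKK fKea).
move=> r /andP[]; rewrite le_eqVlt => /predU1P[<- _|r0 r1].
  by rewrite (F0_Kcut je0 fKa jKa) (F0_Kcut ja0 fu ja) (F0_Kcut jea0 fu jea').
have r01 : 0 < r <= 1 by rewrite r0.
rewrite (F_Kcut je0 fKa jKa r01) (F_Kcut ja0 fu ja r01) (F_Kcut jea0 fu jea' r01).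
rewrite jea; exact: (max_sub_max _ _ (ltW je0)).
Qed.

Lemma Sminus_iter d f n : Sminus j d f n = iter n (KG d) (0, f).
Proof. by elim: n => [//|n IH]; rewrite iterS -IH. Qed.

Lemma Splus_iter d f n : Splus j d f n = iter n (GK d) (0, f).
Proof. by elim: n => [//|n IH]; rewrite iterS -IH. Qed.

Lemma iter_KG_refine e p n u : 0 < e -> j * (p.+1%:R * e) < m -> state u ->
  ule (iter n (KG (p.+1%:R * e)) u) (iter (n * p.+1) (KG e) u).
Proof.
move=> e0 jm su; have pe0 : 0 < p.+1%:R * e by rewrite mulr_gt0.
have jem : j * e < m.
  by apply: le_lt_trans jm; rewrite ler_pM2l// ler_peMl ?(ltW e0)// ler1n.
elim: n => [|n IH]; first by rewrite mul0n /=; exact: ule_refl.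
rewrite iterS mulSn iterD.
have s1 := iter_KG_state pe0 jm n su.
have s2 := iter_KG_state e0 jem (n * p.+1) su.
apply: (ule_trans (KG_ule pe0 jm s1 s2 IH)).
exact: KG_refine.
Qed.

Lemma iter_GK_refine e p n u : 0 < e -> j * (p.+1%:R * e) < m -> state u -> density u ->
  ule (iter (n * p.+1) (GK e) u) (iter n (GK (p.+1%:R * e)) u).
Proof.
move=> e0 jm su du; have pe0 : 0 < p.+1%:R * e by rewrite mulr_gt0.
have jem : j * e < m.
  by apply: le_lt_trans jm; rewrite ler_pM2l// ler_peMl ?(ltW e0)// ler1n.
elim: n => [|n IH]; first by rewrite mul0n /=; exact: ule_refl.
rewrite iterS mulSn iterD.
have [s1 d1] := iter_GK_state pe0 jm n su du.
have [s2 d2] := iter_GK_state e0 jem (n * p.+1) su du.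
apply: ule_trans (GK_ule pe0 jm s2 d2 s1 d1 IH).
exact: GK_refine.
Qed.

End Refinement.

Lemma Linf_pos_finite_pos (R : realType) (u : R -> R) : Linf_pos u -> finite_pos (0, u).
Proof.
move=> [mu0 [u0 [M [N [mN N0 subN]]]]]; split => //.
(* The essential bound is given without a sign, and the domination is by a nonnegative constant. *)
have M0 : 0 <= Num.max M 0 by rewrite le_max lexx orbT.
apply: (@le_lt_trans _ _ (\int[@lebesgue_measure R]_(x in `[0%R, 1%R]) (Num.max M 0)%:E)%E).
  apply: ae_ge0_le_integral => //.
  - exact/measurable_EFinP.
  - exists N; split => // x nx; apply: subN => uxM; apply: nx.
    by rewrite /= in_itv/= lee_fin => x01; rewrite le_max uxM.
by rewrite integral_cst//= lebesgue_measure_itv/= lte_fin ltr01 oppr0 adde0 mule1 ltry.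
Qed.

Theorem mainTheorem2 (R : realType) (j : R) (u : R -> R) :
  0 < j -> Linf_pos u -> 0 < Fd 0 u ->
  forall (delta delta' t : R) (k k' : nat),
    0 < delta -> 0 < delta' ->
    in_Udelta j delta (0, u) -> in_Udelta j delta' (0, u) ->
    t = k%:R * delta -> t = k'%:R * delta' ->
    ule (Sminus j delta u k) (Splus j delta' u k').
Proof.
move=> j0 Lu Fu0 d d' t k k' d0 d'0; rewrite /in_Udelta /= => jd jd' tk tk'.
have fu := Linf_pos_finite_pos Lu.
rewrite Sminus_iter Splus_iter; set m := Fd 0 u in jd jd'.
have du : density m (0, u) by [].
have su : state m (0, u) by split => //; rewrite F_eq0 add0r.
have kd : k%:R * d = k'%:R * d' by rewrite -tk.
case: k k' {tk tk'} kd => [|p] [|q] kd.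
(* The time steps being positive, the two numbers of steps vanish together. *)
- exact: ule_refl.
- by have := mulr_gt0 (ltr0Sn R q) d'0; rewrite -kd mul0r ltxx.
- by have := mulr_gt0 (ltr0Sn R p) d0; rewrite kd mul0r ltxx.
pose e := d / q.+1%:R.
have e0 : 0 < e by rewrite divr_gt0.
have dE : d = q.+1%:R * e by rewrite mulrC divfK// pnatr_eq0.
have d'E : d' = p.+1%:R * e.
  apply: (mulfI (x := q.+1%:R)); first by rewrite pnatr_eq0.
  by rewrite -kd {1}dE; ring.
rewrite dE in jd; rewrite d'E in jd'; rewrite dE d'E.
have jem : j * e < m.
  by apply: le_lt_trans jd; rewrite ler_pM2l// ler_peMl ?(ltW e0)// ler1n.
apply: (ule_trans (iter_KG_refine j0 p.+1 e0 jd su)).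
apply: ule_trans (iter_GK_refine j0 q.+1 e0 jd' su du).
(* Both refinements use the same number [k k'] of steps of size [e]. *)
by rewrite [(q.+1 * _)%N]mulnC; exact: (iter_KG_GK j0 e0 jem _ su du).
Qed.
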